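(* Let $\mathcal{H}$ be a Hilbert space, $\xi\in\mathcal{H}$ a unit vector, and $\varphi_\xi(T)=\langle T\xi,\xi\rangle$. Let $\{V_n\}_{n\ge1}$ be a sequence of Boolean independent, identically distributed, bounded positive operators on $\mathcal{H}$ with respect to $\varphi_\xi$, with $V_1$ distributed as the uniform distribution $U(0,1)$ on $(0,1)$. Put $\tilde V_n=V_1\vee\cdots\vee V_n$ (maximum in the spectral order). Let $F$ be a distribution function on $\mathbb{R}$. Then $$\varphi_\xi\bigl(E_{\tilde V_n}([0,F^{1/n}])\bigr)\xrightarrow{w}(\mathcal{X}^\vee)^{-1}(F),\qquad n\to\infty.$$ In particular, for every $\alpha>0$, $\varphi_\xi\bigl(E_{\tilde V_n}([0,C_{\mathrm{II},\alpha}^{1/n}])\bigr)\xrightarrow{w}B_{\mathrm{II},\alpha}$ as $n\to\infty$.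
   Context: Operators $V_1,V_2,\dots$ are Boolean independent with respect to $\varphi_\xi$ if, letting $\mathcal{A}_i$ be the non-unital $*$-algebra generated by $V_i$, one has $\varphi_\xi(a_1\cdots a_m)=\varphi_\xi(a_1)\cdots\varphi_\xi(a_m)$ whenever $a_j\in\mathcal{A}_{i(j)}$ and $i(1)\ne i(2)\neq\cdots\ne i(m)$ (consecutive indices distinct). For a selfadjoint operator $T$, $E_T$ is its spectral measure and its distribution is $B\mapsto\varphi_\xi(E_T(B))$. For selfadjoint $X,Y$, the maximum $X\vee Y$ in the spectral order is the selfadjoint operator determined by $E_{X\vee Y}((x,\infty))=E_X((x,\infty))\vee E_Y((x,\infty))$ for all $x\in\mathbb{R}$, where $P\vee Q$ for projections is the projection onto the closure of $P\mathcal{H}+Q\mathcal{H}$. For a distribution function $F$, $\varphi_\xi(E_{\tilde V_n}([0,F^{1/n}]))$ denotes the function $x\mapsto\varphi_\xi(E_{\tilde V_n}([0,F(x)^{1/n}]))$ on $\mathbb{R}$. The notation $H_n\xrightarrow{w}H$ means $H_n(x)\to H(x)$ at every continuity point $x$ of $H$. $\mathcal{X}^\vee:[0,1]\to[0,1]$ is the bijection $\mathcal{X}^\vee(0)=0$, $\mathcal{X}^\vee(x)=\exp(1-x^{-1})$ for $x\in(0,1]$, with inverse $(\mathcal{X}^\vee)^{-1}(0)=0$, $(\mathcal{X}^\vee)^{-1}(x)=\frac{1}{1-\log x}$ for $x\in(0,1]$; $(\mathcal{X}^\vee)^{-1}(F)$ is the distribution function $x\mapsto(\mathcal{X}^\vee)^{-1}(F(x))$.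 $C_{\mathrm{II},\alpha}(x)=\exp(-x^{-\alpha})$ for $x>0$ and $0$ for $x\le 0$ (Fréchet distribution); $B_{\mathrm{II},\alpha}(x)=(1+x^{-\alpha})^{-1}$ for $x>0$ and $0$ for $x\le 0$ (Dagum distribution). *)

(* Defs.v *)
From HB Require Import structures.
From mathcomp Require Import all_boot all_order all_algebra.
From mathcomp Require Import complex.
From mathcomp Require Import all_classical all_reals all_analysis.

Set Implicit Arguments.
Unset Strict Implicit.
Unset Printing Implicit Defensive.

Import Order.TTheory GRing.Theory Num.Theory.
Import numFieldNormedType.Exports.

Local Open Scope classical_set_scope.
Local Open Scope complex_scope.
Local Open Scope ring_scope.

(* A complex Hilbert space is a complete normed module over R[i] with a
   positive definite Hermitian form inducing its norm. The form is linear in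
   its first argument and conjugate-linear in the second one. *)
Definition induces_norm (R : realType) (H : completeNormedModType R[i])
    (dot : {dot H for (Num.conj : R[i] -> R[i])}) : Prop :=
  forall x : H, dot x x = `|x| ^+ 2.

Section Operators.
Context {R : realType} {H : completeNormedModType R[i]}.
Variable dot : {dot H for (Num.conj : R[i] -> R[i])}.
Implicit Types (T A B P Q J X Y Z : H -> H).
Implicit Types (C D : set (measurableTypeR R)).

Definition bounded_operator T : Prop :=
  linear T /\ exists M : R[i], forall x, `|T x| <= M * `|x|.

Definition is_adjoint A B : Prop := forall x y, dot (A x) y = dot x (B y).

Definition selfadjoint T : Prop := is_adjoint T T.

(* In R[i], 0 <= z means that z is real and nonnegative. *)
Definition positive_operator T : Prop := forall x, 0 <= dot (T x) x.

Definition orthogonal_projection P : Prop :=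
  [/\ linear P, P \o P = P & selfadjoint P].

Definition is_projection_join P Q J : Prop :=
  orthogonal_projection J /\
  range J = closure [set P x + Q y | x in [set: H] & y in [set: H]].

(* The last clause is countable additivity in the strong operator topology. *)
Definition projection_valued_measure (E : set (measurableTypeR R) -> H -> H) :
    Prop :=
  [/\ forall D, measurable D -> orthogonal_projection (E D),
      E [set: _] = idfun,
      forall C D, measurable C -> measurable D -> E (C `&` D) = E C \o E D &
      forall F : nat -> set (measurableTypeR R),
        (forall k, measurable (F k)) -> trivIset [set: nat] F ->
        forall x, series (fun k => E (F k) x) @ \oo --> E (\bigcup_k F k) x].

(* The spectral resolution of T: E is a projection-valued Borel measure on the
   line, and <T x, x> is the integral of the identity function against the
   scalar measure D |-> <E(D) x, x>, for all x. *)
Definition is_spectral_measure T (E : set (measurableTypeR R) -> H -> H) :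
    Prop :=
  projection_valued_measure E /\
  forall x, exists mu : {measure set (measurableTypeR R) -> \bar R},
    [/\ forall D, measurable D -> mu D = (complex.Re (dot (E D x) x))%:E,
        mu.-integrable [set: _] (EFin : measurableTypeR R -> \bar R) &
        dot (T x) x = (\int[mu]_(t in [set: _]) (t : R))%:C].

(* Z is the maximum of X and Y in the spectral order. The maximum of two
   bounded selfadjoint operators is bounded. *)
Definition is_spectral_max X Y Z : Prop :=
  [/\ bounded_operator Z, selfadjoint Z &
    exists EX EY EZ : set (measurableTypeR R) -> H -> H,
      [/\ is_spectral_measure X EX, is_spectral_measure Y EY,
          is_spectral_measure Z EZ &
          forall t : R, is_projection_join
            (EX `]t, +oo[%classic) (EY `]t, +oo[%classic)
            (EZ `]t, +oo[%classic)]].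

(* Ts n is the maximum of Vs 0, ..., Vs n. *)
Definition is_running_max (Vs Ts : nat -> H -> H) : Prop :=
  Ts 0 = Vs 0 /\ forall n, is_spectral_max (Ts n) (Vs n.+1) (Ts n.+1).

Inductive star_algebra (T : H -> H) : (H -> H) -> Prop :=
| star_algebra_gen : star_algebra T T
| star_algebra_add A B : star_algebra T A -> star_algebra T B ->
    star_algebra T (fun x => A x + B x)
| star_algebra_scale (c : R[i]) A : star_algebra T A ->
    star_algebra T (fun x => c *: A x)
| star_algebra_mul A B : star_algebra T A -> star_algebra T B ->
    star_algebra T (A \o B)
| star_algebra_adj A B : star_algebra T A -> is_adjoint A B ->
    star_algebra T B.

Variable xi : H.

Definition vector_state T : R[i] := dot (T xi) xi.

Definition boolean_independent (Vs : nat -> H -> H) : Prop :=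
  forall (m : nat) (i : nat -> nat) (a : nat -> H -> H),
    (0 < m)%N ->
    (forall j, (j < m)%N -> star_algebra (Vs (i j)) (a j)) ->
    (forall j, (j.+1 < m)%N -> i j <> i j.+1) ->
    vector_state (\big[(fun A B => A \o B)/idfun]_(j < m) a j) =
    \prod_(j < m) vector_state (a j).

(* For an orthogonal projection the vector state is a real number. *)
Definition spectral_law (E : set (measurableTypeR R) -> H -> H)
    (D : set (measurableTypeR R)) : R :=
  complex.Re (vector_state (E D)).

Definition has_distribution T (mu : set (measurableTypeR R) -> \bar R) : Prop :=
  exists2 E, is_spectral_measure T E &
    forall D, measurable D -> (spectral_law E D)%:E = mu D.

Definition same_distribution X Y : Prop :=
  exists EX EY, [/\ is_spectral_measure X EX, is_spectral_measure Y EY &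
    forall D, measurable D -> spectral_law EX D = spectral_law EY D].

End Operators.

Section DistributionFunctions.
Context {R : realType}.
Implicit Types (x u alpha : R).

Definition weak_cvg (Gn : nat -> R -> R) (G : R -> R) : Prop :=
  forall x, {for x, continuous G} -> Gn n x @[n --> \oo] --> G x.

Definition Xvee x : R := if x == 0 then 0 else expR (1 - x^-1).

Definition Xvee_inv u : R := if u == 0 then 0 else (1 - ln u)^-1.

Lemma XveeK : cancel Xvee Xvee_inv.
Proof.
move=> x; rewrite /Xvee; case: (eqVneq x 0) => [->|x0].
  by rewrite /Xvee_inv eqxx.
by rewrite /Xvee_inv gt_eqF ?expR_gt0// expRK opprB addrC subrK invrK.
Qed.

Lemma Xvee_invK u : 0 <= u <= 1 -> Xvee (Xvee_inv u) = u.
Proof.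
move=> /andP[u0 u1]; rewrite /Xvee_inv; case: (eqVneq u 0) => [->|un0].
  by rewrite /Xvee eqxx.
have lnu : ln u <= 0 by exact: ln_le0.
have up : 0 < u by rewrite lt_def un0.
rewrite /Xvee invr_eq0 gt_eqF ?invrK; last first.
  by rewrite subr_gt0 (le_lt_trans lnu).
by rewrite opprB addrC subrK lnK.
Qed.

Definition frechet_cdf alpha x : R :=
  if 0 < x then expR (- (x `^ (- alpha))) else 0.

Definition dagum_cdf alpha x : R :=
  if 0 < x then (1 + x `^ (- alpha))^-1 else 0.

End DistributionFunctions.

(* Main.v *)
Require Import Defs.
From HB Require Import structures.
From mathcomp Require Import all_boot all_order all_algebra.
From mathcomp Require Import complex.
From mathcomp Require Import all_classical all_reals all_analysis.
From mathcomp Require Import ring lra.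

Set Implicit Arguments.
Unset Strict Implicit.
Unset Printing Implicit Defensive.

Import Order.TTheory GRing.Theory Num.Theory.
Import numFieldNormedType.Exports.

Local Open Scope classical_set_scope.
Local Open Scope complex_scope.
Local Open Scope ring_scope.

(** Fix a threshold t > 0 and write P_j for the spectral projection of V_j on
    ]t, +oo[, J_n for that of the running maximum, and p for the common value
    of <P_j xi, xi>, which is 1 - t when t <= 1. The whole computation takes
    place in the span of the vectors P_j xi.

    Boolean independence concerns the algebras without unit generated by the
    V_j. As t > 0, the indicator of ]t, +oo[ vanishes at 0, so P_j is the strong
    limit of polynomials in V_j without constant term
    ([spectral_approximation]); explicit ones are 1 - (1 - (u / M)^(2m))^N with
    M above the norm of V_j and a suitable N depending on m. For a in the
    algebra of V_i and b in that of V_j, both selfadjoint and i <> j, expanding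
    the square shows that the norm of a b xi - <b xi, xi> a xi is 0
    ([boolean_independent_vector]). In the limit, P_i P_j xi = p P_i xi
    ([boolean_independent_projection]).

    The range of J_n is the closure of the sum of the ranges of P_0, ..., P_n,
    so J_n fixes the ranges of the P_j and kills every vector that all the P_j
    kill ([running_max_join]). Here one needs that spectral projections are
    determined by the operator, because every maximum is defined through
    spectral measures of its own; since the approximating polynomials depend on
    the operator only, this is again [spectral_approximation]. Put
    c = 1 / (1 + n p). By the relation above, every P_i kills
    xi - c (P_0 xi + ... + P_n xi), whence
    J_n xi = c (P_0 xi + ... + P_n xi) and
    <J_n xi, xi> = (n + 1) p / (1 + n p) ([law_running_max_gt]).

    With p = 1 - s this says that the maximum gives [0, s] the mass
    s / (1 + n (1 - s)) = 1 / (1 + (n + 1) (1 / s - 1)). For s = u^(1 / (n + 1))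
    and 0 < u, the quantity (n + 1) (1 / s - 1) tends to - ln u, so the mass
    tends to 1 / (1 - ln u); for u = 0 it is 0 ([cvg_law]). The convergence
    holds for every u in [0, 1], so it holds at every point for every
    distribution function, and the Frechet case at x > 0 is the instance
    ln u = - x^(- alpha). *)

(** * Real inner products and norms *)

Section Hilbert.
Context {R : realType} {H : completeNormedModType R[i]}.
Variable dot : {dot H for (Num.conj : R[i] -> R[i])}.
Hypothesis hdot : induces_norm dot.
Implicit Types (x y z : H) (T A B P Q S : H -> H) (a b c : R).

(** The order of the complex numbers is only partial. Passing to real parts
    turns all estimates into inequalities between real numbers. *)
Definition real_dot x y : R := complex.Re (dot x y).
Local Notation rdot := real_dot.
Definition nrm x : R := complex.Re `|x|.

Lemma normE x : `|x| = (nrm x)%:C.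
Proof. by rewrite RRe_real// normr_real. Qed.

Lemma nrm_ge0 x : 0 <= nrm x.
Proof. by rewrite -ler0c -normE. Qed.

Lemma nrm_eq0 x : nrm x = 0 -> x = 0.
Proof. by move=> x0; apply/eqP; rewrite -normr_eq0 normE x0. Qed.

Lemma nrm_sqr_eq0 x : nrm x ^+ 2 = 0 -> x = 0.
Proof. by move=> /eqP; rewrite sqrf_eq0 => /eqP/nrm_eq0. Qed.

Lemma nrmB_eq0 x y : nrm (x - y) = 0 -> x = y.
Proof. by move=> /nrm_eq0/eqP; rewrite subr_eq0 => /eqP. Qed.

Lemma nrmB_sqr_eq0 x y : nrm (x - y) ^+ 2 = 0 -> x = y.
Proof. by move=> /nrm_sqr_eq0/eqP; rewrite subr_eq0 => /eqP. Qed.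

Lemma nrm0 : nrm 0 = 0.
Proof. by rewrite /nrm normr0. Qed.

Lemma ler_nrmD x y : nrm (x + y) <= nrm x + nrm y.
Proof. by have := ler_normD x y; rewrite !normE -rmorphD/= lecR. Qed.

Lemma nrmN x : nrm (- x) = nrm x.
Proof. by rewrite /nrm normrN. Qed.

Lemma ler_nrmB x y : nrm (x - y) <= nrm x + nrm y.
Proof. by rewrite (le_trans (ler_nrmD _ _))// nrmN. Qed.

Lemma normc_real c : `|c%:C| = `|c|%:C.
Proof. by rewrite normc_def/= expr0n/= addr0 sqrtr_sqr. Qed.

Lemma nrmZ c x : nrm (c%:C *: x) = `|c| * nrm x.
Proof. by apply: complexI; rewrite rmorphM/= -!normE normrZ normc_real. Qed.

Lemma rdotxx x : rdot x x = nrm x ^+ 2.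
Proof. by rewrite /real_dot hdot normE -rmorphXn. Qed.

Lemma dotC x y : dot x y = (dot y x)^*.
Proof. by rewrite hermC expr0 mul1r. Qed.

Lemma conjCE (z : R[i]) : Num.conj z = conjc z.
Proof. by []. Qed.

Lemma rdotC x y : rdot x y = rdot y x.
Proof. by rewrite /real_dot dotC; case: (dot y x). Qed.

Lemma ReD (u v : R[i]) : complex.Re (u + v) = complex.Re u + complex.Re v.
Proof. by case: u v => [? ?] []. Qed.
Lemma ReN (u : R[i]) : complex.Re (- u) = - complex.Re u.
Proof. by case: u. Qed.
Lemma ReM c (u : R[i]) : complex.Re (c%:C * u) = c * complex.Re u.
Proof. by case: u => ? ? /=; rewrite mul0r subr0. Qed.

Lemma rdotDl x y z : rdot (x + y) z = rdot x z + rdot y z.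
Proof. by rewrite /real_dot linearDl ReD. Qed.
Lemma rdotNl x z : rdot (- x) z = - rdot x z.
Proof. by rewrite /real_dot linearNl ReN. Qed.
Lemma rdotZl c x z : rdot (c%:C *: x) z = c * rdot x z.
Proof. by rewrite /real_dot linearZl_LR ReM. Qed.
Lemma rdotDr x y z : rdot z (x + y) = rdot z x + rdot z y.
Proof. by rewrite !(rdotC z) rdotDl. Qed.
Lemma rdotNr x z : rdot z (- x) = - rdot z x.
Proof. by rewrite !(rdotC z) rdotNl. Qed.
Lemma rdotZr c x z : rdot z (c%:C *: x) = c * rdot z x.
Proof. by rewrite !(rdotC z) rdotZl. Qed.

Lemma nrmB_sqr x y : nrm (x - y) ^+ 2 = nrm x ^+ 2 - 2 * rdot x y + nrm y ^+ 2.
Proof.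
by rewrite -!rdotxx !(rdotDl, rdotDr, rdotNl, rdotNr) (rdotC y x); ring.
Qed.

Lemma CauchySchwarz_rdot x y : `|rdot x y| <= nrm x * nrm y.
Proof.
rewrite -(@ler_pXn2r _ 2)// ?nnegrE ?mulr_ge0 ?nrm_ge0//.
have [->|y0] := eqVneq y 0; 
  first by rewrite /real_dot linear0r/= normr0 nrm0 mulr0.
have ny : 0 < nrm y ^+ 2.
  rewrite exprn_gt0// lt_def nrm_ge0 andbT.
  by apply/eqP => /nrm_eq0/eqP; exact/negP.
have := sqr_ge0 (nrm (x - (rdot x y / nrm y ^+ 2)%:C *: y)).
rewrite nrmB_sqr nrmZ rdotZr exprMn real_normK ?num_real//.
move: (nrm y) (nrm x) (rdot x y) ny => n m u ny h.
have n0 : n != 0 by apply: contraTneq ny => ->; rewrite expr0n ltxx.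
suff -> : (m * n) ^+ 2 = (m ^+ 2 - 2 * (u / n ^+ 2 * u) +
    (u / n ^+ 2) ^+ 2 * n ^+ 2) * n ^+ 2 + u ^+ 2.
  by rewrite real_normK ?num_real// lerDr mulr_ge0// ltW.
by field.
Qed.

End Hilbert.

(** * Operator bounds from quadratic forms *)
Section FormBounds.
Context {R : realType} {H : completeNormedModType R[i]}.
Variable dot : {dot H for (Num.conj : R[i] -> R[i])}.
Hypothesis hdot : induces_norm dot.
Implicit Types (x y z : H) (T A B P Q S : H -> H) (a b c : R) (K : set H).
Local Notation rdot := (real_dot dot).

Lemma linear_opD T x y : linear T -> T (x + y) = T x + T y.
Proof. by move=> /(_ 1 x y); rewrite !scale1r. Qed.

Lemma linear_op0 T : linear T -> T 0 = 0.
Proof. by move=> lT; apply: (addrI (T 0)); rewrite -linear_opD// !addr0. Qed.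

Lemma linear_opZ T (c : R[i]) x : linear T -> T (c *: x) = c *: T x.
Proof. by move=> lT; have := lT c x 0; rewrite (linear_op0 lT) !addr0. Qed.

Lemma linear_opB T x y : linear T -> T (x - y) = T x - T y.
Proof.
move=> lT.
by rewrite (linear_opD _ _ lT) -[- y]scaleN1r (linear_opZ _ _ lT) scaleN1r.
Qed.

Lemma linear_op_sum T (I : Type) (r : seq I) (f : I -> H) :
  linear T -> T (\sum_(i <- r) f i) = \sum_(i <- r) T (f i).
Proof.
move=> lT; apply: (big_morph T) => [x y|]; last exact: linear_op0.
exact: linear_opD.
Qed.

Lemma linear_iter A m : linear A -> linear (iter m A).
Proof.
move=> lA; elim: m => [//|m IH] c x y; rewrite !iterS -lA.
congr (A _); exact: IH.
Qed.

Lemma selfadjoint_rdot T x y : selfadjoint dot T -> rdot (T x) y = rdot x (T y).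
Proof. by move=> sT; rewrite /real_dot sT. Qed.

Lemma selfadjoint_iter A m : selfadjoint dot A -> selfadjoint dot (iter m A).
Proof.
by move=> sA; elim: m => [//|m IH] x y; rewrite [in LHS]iterS sA IH -iterSr.
Qed.

Lemma rdot_iter_double A m x : selfadjoint dot A ->
  rdot (iter m.*2 A x) x = nrm (iter m A x) ^+ 2.
Proof.
move=> sA; rewrite -addnn iterD -(rdotxx hdot) selfadjoint_rdot//.
exact: selfadjoint_iter.
Qed.

(** The estimates below only combine vectors with real coefficients, so real
    linear subspaces are enough. *)
Definition invariant_subspace T K :=
  (forall x, K x -> K (T x)) /\ forall x y c, K x -> K y -> K (x - c%:C *: y).

Lemma invariant_subspace_iter A K m :
  invariant_subspace A K -> invariant_subspace (iter m A) K.
Proof.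
move=> [KA KB]; split=> // x Kx.
by elim: m => //= m; exact: KA.
Qed.

Lemma invariant_subspaceB S K :
  invariant_subspace S K -> invariant_subspace (fun x => x - S x) K.
Proof.
move=> [KA KB]; split=> // x Kx.
by have := KB _ _ 1 Kx (KA _ Kx); rewrite scale1r.
Qed.

(** Nonnegativity of the form at x - b^-1 T x gives T^2 <= b T, in the sense of
    forms, and then |T x|^2 <= b <T x, x> <= b^2 |x|^2. *)
Lemma nrm_le_form T K b : linear T -> selfadjoint dot T ->
  invariant_subspace T K -> 0 < b ->
  (forall x, K x -> 0 <= rdot (T x) x <= b * nrm x ^+ 2) ->
  forall x, K x -> nrm (T x) <= b * nrm x.
Proof.
move=> lT sT [KT KB] b0 hK x Kx.
have /andP[_ hTx] := hK _ (KT _ Kx).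
have /andP[_ hx] := hK _ Kx.
have /andP[h _] := hK _ (KB _ _ b^-1 Kx (KT _ Kx)).
rewrite linear_opB// linear_opZ// in h.
rewrite !(rdotDl, rdotDr, rdotNl, rdotNr, rdotZl, rdotZr) in h.
rewrite (selfadjoint_rdot (T x))// (rdotxx hdot) in h.
rewrite -(@ler_pXn2r _ 2)// ?nnegrE ?mulr_ge0 ?nrm_ge0 ?(ltW b0)//.
have hb : b^-1 * rdot (T (T x)) (T x) <= nrm (T x) ^+ 2.
  by rewrite ler_pdivrMl.
have {}h : b^-1 * nrm (T x) ^+ 2 <= rdot (T x) x.
  have : b^-1 * (b^-1 * rdot (T (T x)) (T x)) <= b^-1 * nrm (T x) ^+ 2.
    by rewrite ler_pM2l ?invr_gt0.
  move: h; lra.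
rewrite exprMn -ler_pdivrMl ?exprn_gt0//.
have -> : (b ^+ 2)^-1 * nrm (T x) ^+ 2 = b^-1 * (b^-1 * nrm (T x) ^+ 2).
  by rewrite mulrA -expr2 exprVn.
by rewrite ler_pdivrMl// (le_trans h).
Qed.

(** Expand 0 <= |T x - a x|^2. *)
Lemma nrm_ge_form T a x : 0 <= a -> a * nrm x ^+ 2 <= rdot (T x) x ->
  a * nrm x <= nrm (T x).
Proof.
move=> a0 h; rewrite -(@ler_pXn2r _ 2)// ?nnegrE ?mulr_ge0 ?nrm_ge0//.
have := sqr_ge0 (nrm (T x - a%:C *: x)).
rewrite (nrmB_sqr hdot) rdotZr nrmZ ger0_norm//.
have : a * (a * nrm x ^+ 2) <= a * rdot (T x) x by rewrite ler_wpM2l.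
rewrite exprMn; lra.
Qed.

Lemma nrm_iter_le A K b m : 0 <= b -> invariant_subspace A K ->
  (forall x, K x -> nrm (A x) <= b * nrm x) ->
  forall x, K x -> nrm (iter m A x) <= b ^+ m * nrm x.
Proof.
move=> b0 [KA _] h x Kx; have KI : forall k, K (iter k A x).
  by elim=> //= k; exact: KA.
elim: m => [|m IH] /=; first by rewrite mul1r.
by rewrite (le_trans (h _ (KI m)))// exprS -mulrA ler_wpM2l.
Qed.

Lemma nrm_iter_ge A K b m : 0 <= b -> invariant_subspace A K ->
  (forall x, K x -> b * nrm x <= nrm (A x)) ->
  forall x, K x -> b ^+ m * nrm x <= nrm (iter m A x).
Proof.
move=> b0 [KA _] h x Kx; have KI : forall k, K (iter k A x).
  by elim=> //= k; exact: KA.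
elim: m => [|m IH] /=; first by rewrite mul1r.
by rewrite (le_trans _ (h _ (KI m)))// exprS -mulrA ler_wpM2l.
Qed.

(** * Polynomial cutoffs *)

(** The polynomial 1 - (1 - u^(2m))^N in A. It has no constant term, and on
    [0, 1] it is close to 0 where N u^(2m) is small and close to 1 where
    N u^(2m) is large. The exponent is even because the form of A^(2m) at x is
    then |A^m x|^2, which is controlled by norm bounds on A. *)
Definition cutoff A m N x := x - iter N (fun y => y - iter m.*2 A y) x.

Section cutoff.
Variables (A : H -> H) (m : nat).
Hypotheses (lA : linear A) (sA : selfadjoint dot A).
Hypothesis A01 : forall x, 0 <= rdot (A x) x <= nrm x ^+ 2.

Let G x := x - iter m.*2 A x.

Let invT : invariant_subspace A setT. Proof. by []. Qed.

Let lG : linear G.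
Proof.
move=> c x y; rewrite /G (linear_iter m.*2 lA) scalerBr opprD.
by rewrite !addrA; congr (_ - _); rewrite addrAC.
Qed.

Let sG : selfadjoint dot G.
Proof.
move=> x y; rewrite /G !(linearDl, linearNl, linearDr, linearNr)/=.
by rewrite selfadjoint_iter.
Qed.

Let nrmA x : nrm (A x) <= nrm x.
Proof.
rewrite -[leRHS]mul1r; apply: (nrm_le_form lA sA invT) => //.
by move=> y _; rewrite mul1r.
Qed.

Let nrmAm x k : nrm (iter k A x) <= nrm x.
Proof.
rewrite -[leRHS]mul1r -[X in X * _](expr1n _ k).
by apply: (nrm_iter_le _ _ invT) => // y _; rewrite mul1r.
Qed.

Let rdotG x : rdot (G x) x = nrm x ^+ 2 - nrm (iter m A x) ^+ 2.
Proof. by rewrite /G rdotDl rdotNl rdot_iter_double// (rdotxx hdot). Qed.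

Let rdotG_ge0 x : 0 <= rdot (G x) x.
Proof. by rewrite rdotG subr_ge0 ler_pXn2r ?nnegrE ?nrm_ge0. Qed.

Let cutoffC N x : x - cutoff A m N x = iter N G x.
Proof. by rewrite /cutoff opprB addrC subrK. Qed.

Let nrmG x : nrm (G x) <= nrm x.
Proof.
rewrite -[leRHS]mul1r.
apply: (nrm_le_form lG sG (_ : invariant_subspace _ setT)) => // y _.
by rewrite rdotG_ge0 rdotG mul1r gerBl sqr_ge0.
Qed.

(** Where the form of A is at least a, that of A^(2m) is at least a^(2m), so
    1 - A^(2m) lies between 0 and 1 - a^(2m). *)
Lemma nrm_cutoffC_high K a N : invariant_subspace A K -> (0 < m)%N ->
  0 <= a < 1 -> (forall x, K x -> a * nrm x ^+ 2 <= rdot (A x) x) ->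
  forall x, K x -> nrm (x - cutoff A m N x) <= (1 - a ^+ m.*2) ^+ N * nrm x.
Proof.
move=> invA m0 /andP[a0 a1] hK x Kx; rewrite cutoffC.
have am : a ^+ m.*2 < 1 by rewrite exprn_ilt1// -lt0n double_gt0.
have invG : invariant_subspace G K.
  exact/invariant_subspaceB/invariant_subspace_iter.
apply: (nrm_iter_le _ _ invG) => //; first by rewrite subr_ge0 ltW.
move=> {x Kx}; apply: (nrm_le_form lG sG invG); first by rewrite subr_gt0.
move=> x Kx; rewrite rdotG_ge0 rdotG mulrBl mul1r lerD2l lerN2.
rewrite andTb -muln2 exprM -exprMn.
rewrite ler_pXn2r ?nnegrE ?mulr_ge0 ?nrm_ge0 ?exprn_ge0//.
by apply: (nrm_iter_ge _ a0 invA) => // y /hK; exact: nrm_ge_form.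
Qed.

(** The operator version of 1 - (1 - v)^N <= N v. *)
Lemma nrm_cutoff_low K b N : invariant_subspace A K -> 0 < b ->
  (forall x, K x -> rdot (A x) x <= b * nrm x ^+ 2) ->
  forall x, K x -> nrm (cutoff A m N x) <= (N%:R * b ^+ m.*2) * nrm x.
Proof.
move=> invA b0 hK x Kx; rewrite /cutoff -/G.
have hS : nrm (iter m.*2 A x) <= b ^+ m.*2 * nrm x.
  apply: (nrm_iter_le _ (ltW b0) invA) => //.
  apply: (nrm_le_form lA sA invA b0) => y Ky.
  by rewrite hK// andbT; case/andP: (A01 y).
elim: N => [|N IH] /=; first by rewrite subrr nrm0 !mul0r.
have -> : x - G (iter N G x) = (x - iter N G x) + iter N G (iter m.*2 A x).
  rewrite -iterS iterSr {2}/G (linear_opB _ _ (linear_iter N lG)) opprB addrA.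
  by rewrite addrAC addrC.
rewrite (le_trans (ler_nrmD _ _))// -natr1 mulrDl mul1r mulrDl lerD//.
apply: le_trans hS; elim: N {IH} => //= N; apply: le_trans; exact: nrmG.
Qed.

Lemma nrm_cutoffC N x : nrm (x - cutoff A m N x) <= nrm x.
Proof. by rewrite cutoffC; elim: N => //= N; apply: le_trans; exact: nrmG. Qed.

Lemma linear_cutoff N : linear (cutoff A m N).
Proof.
move=> c x y; rewrite /cutoff -/G (linear_iter N lG) scalerBr opprD.
by rewrite !addrA; congr (_ - _); rewrite addrAC.
Qed.

Lemma selfadjoint_cutoff N : selfadjoint dot (cutoff A m N).
Proof.
move=> x y; rewrite /cutoff -/G !(linearDl, linearNl, linearDr, linearNr)/=.
by rewrite (selfadjoint_iter N sG).
Qed.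

End cutoff.
End FormBounds.

(** * Spectral measures *)
Section SpectralMeasure.
Context {R : realType} {H : completeNormedModType R[i]}.
Variable dot : {dot H for (Num.conj : R[i] -> R[i])}.
Hypothesis hdot : induces_norm dot.
Implicit Types (x y z : H) (A B P Q S : H -> H) (a b c : R).
Implicit Types (C D : set (measurableTypeR R)).
Local Notation rdot := (real_dot dot).

Lemma projectionK P x : orthogonal_projection dot P -> P (P x) = P x.
Proof. by case=> _ PP _; rewrite -[LHS]/((P \o P) x) PP. Qed.

Lemma rdot_projection P x : orthogonal_projection dot P ->
  rdot (P x) x = nrm (P x) ^+ 2.
Proof.
move=> pP; have [_ _ sP] := pP.
by rewrite -(rdotxx hdot) -selfadjoint_rdot// projectionK.
Qed.

Lemma nrm_projection_le P x : orthogonal_projection dot P -> nrm (P x) <= nrm x.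
Proof.
move=> pP; have := CauchySchwarz_rdot hdot (P x) x.
rewrite rdot_projection// ger0_norm ?sqr_ge0// expr2.
have [->|Px0] := eqVneq (nrm (P x)) 0; first by rewrite nrm_ge0.
by rewrite ler_pM2l// lt_def Px0 nrm_ge0.
Qed.

(** Polarization, at x + y and at x + i y. *)
Lemma real_form_selfadjoint A : linear A ->
  (forall x, complex.Im (dot (A x) x) = 0) -> selfadjoint dot A.
Proof.
move=> lA h x y; rewrite [RHS](dotC dot).
have := h (x + y); have := h (x + 'i%C *: y).
rewrite !(linear_opD _ _ lA) !(linear_opZ _ _ lA).
rewrite !(linearDl, linearDr) !(linearZl_LR, linearZr_LR)/=.
move: (h x) (h y); case: (dot (A x) x) => [? ?] /= ->.
case: (dot (A y) y) => [? ?] /= ->.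
case: (dot (A x) y) (dot (A y) x) => [p q] [r s] /=.
move=> h1 h2; apply/eqP; rewrite eq_complex/=.
by apply/andP; split; apply/eqP; lra.
Qed.

Variables (T : H -> H) (E : set (measurableTypeR R) -> H -> H).
Hypothesis lT : linear T.
Hypothesis hE : is_spectral_measure dot T E.

Let pE D : measurable D -> orthogonal_projection dot (E D).
Proof. by case: hE => -[+ _ _ _] _; exact. Qed.

Lemma spectral_projection D : measurable D -> orthogonal_projection dot (E D).
Proof. exact: pE. Qed.

Lemma spectral_measureT x : E setT x = x.
Proof. by case: hE => -[_ -> _ _] _. Qed.

Lemma spectral_measureI C D x : measurable C -> measurable D ->
  E (C `&` D) x = E C (E D x).
Proof. by move=> mC mD; case: hE => -[_ _ h _] _; rewrite h. Qed.

Lemma scalar_spectral_measure x :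
  exists mu : {measure set (measurableTypeR R) -> \bar R},
  [/\ forall D, measurable D -> mu D = (nrm (E D x) ^+ 2)%:E,
      mu.-integrable setT (EFin : measurableTypeR R -> \bar R) &
      dot (T x) x = (\int[mu]_(t in setT) (t : R))%:C].
Proof.
case: hE => _ /(_ x)[mu [h1 h2 h3]]; exists mu; split => // D mD.
by rewrite h1// -rdot_projection//; exact: pE.
Qed.

Lemma spectral_measure_selfadjoint : selfadjoint dot T.
Proof.
apply: real_form_selfadjoint => // x.
by have [mu [_ _ ->]] := scalar_spectral_measure x.
Qed.

Lemma spectral_measure0 x : E set0 x = 0.
Proof.
have [mu [h _ _]] := scalar_spectral_measure x.
have : mu set0 = 0%E by exact: measure0.
by rewrite h// => -[/nrm_sqr_eq0].
Qed.

(** The squared norm of the difference of both sides is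
    mu (C `|` D) - mu C - mu D, for mu the scalar measure of x. *)
Lemma spectral_measureU C D x : measurable C -> measurable D ->
  C `&` D = set0 -> E (C `|` D) x = E C x + E D x.
Proof.
move=> mC mD CD0; have mCD : measurable (C `|` D) by exact: measurableU.
apply: nrmB_sqr_eq0.
have EE (B : set (measurableTypeR R)) : measurable B -> B `<=` C `|` D ->
    rdot (E (C `|` D) x) (E B x) = nrm (E B x) ^+ 2.
  move=> mB BCD; have [_ _ s] := pE mCD; rewrite selfadjoint_rdot//.
  rewrite -spectral_measureI// setIidr// rdotC rdot_projection//; exact: pE.
have ECD : rdot (E C x) (E D x) = 0.
  have [_ _ s] := pE mC; rewrite selfadjoint_rdot// -spectral_measureI// CD0.
  by rewrite spectral_measure0 /real_dot linear0r.
have [mu [h _ _]] := scalar_spectral_measure x.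
have : mu (C `|` D) = (mu C + mu D)%E by exact: measureU.
rewrite !h// -EFinD => -[hU].
rewrite opprD addrA.
rewrite (nrmB_sqr hdot) rdotDl rdotNl ECD (nrmB_sqr hdot).
rewrite (EE _ mC)//; rewrite (EE _ mD)//.
rewrite hU; ring.
Qed.

Lemma spectral_measureC D x : measurable D -> E (~` D) x = x - E D x.
Proof.
move=> mD; rewrite -[X in X - _]spectral_measureT -(setUv D).
rewrite spectral_measureU//.
- by rewrite addrAC subrr add0r.
- exact: measurableC.
- exact: setICr.
Qed.

Definition spectral_subspace D := [set x | E D x = x].

Lemma spectral_subspaceE D x : measurable D -> spectral_subspace D (E D x).
Proof. by move=> mD; exact/projectionK/pE. Qed.

Lemma scalar_spectral_measureC0 D x
    (mu : {measure set (measurableTypeR R) -> \bar R}) :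
  measurable D -> spectral_subspace D x ->
  (forall C, measurable C -> mu C = (nrm (E C x) ^+ 2)%:E) -> mu (~` D) = 0%E.
Proof.
move=> mD xD h; rewrite h; last exact: measurableC.
by rewrite spectral_measureC// xD subrr nrm0 expr0n.
Qed.

(** The scalar measure of a vector in the range of E D is carried by D. *)
Lemma integral_spectral_subspace D x
    (mu : {measure set (measurableTypeR R) -> \bar R}) :
  measurable D -> spectral_subspace D x ->
  (forall C, measurable C -> mu C = (nrm (E C x) ^+ 2)%:E) ->
  mu.-integrable setT (EFin : measurableTypeR R -> \bar R) ->
  (\int[mu]_t t%:E = \int[mu]_(t in D) t%:E)%E.
Proof.
move=> mD xD h hi; rewrite -[in RHS](setIT D) -[in RHS](setCK D) setIC -setDE.
apply: negligible_integral => //.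
- exact: measurableC.
- exact: scalar_spectral_measureC0 h.
Qed.

Lemma rdot_spectral_subspace_ge D a x :
  measurable D -> (forall t, D t -> a <= t) ->
  spectral_subspace D x -> a * nrm x ^+ 2 <= rdot (T x) x.
Proof.
move=> mD Da xD; have [mu [h1 h2 h3]] := scalar_spectral_measure x.
rewrite /real_dot h3/= -lee_fin fineK; last exact: integrable_fin_num.
rewrite (integral_spectral_subspace mD xD h1 h2).
have <- : (\int[mu]_(t in D) a%:E = (a * nrm x ^+ 2)%:E)%E.
  by rewrite integral_cst// h1// xD -EFinM.
apply: le_integral => //.
- apply/integrableP; split; first exact: measurable_cst.
  by rewrite integral_cst// h1// xD -EFinM ltry.
- exact: (integrableS measurableT).
- by move=> t /set_mem Dt; rewrite lee_fin; exact: Da.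
Qed.

Lemma rdot_spectral_subspace_le D b x :
  measurable D -> (forall t, D t -> t <= b) ->
  spectral_subspace D x -> rdot (T x) x <= b * nrm x ^+ 2.
Proof.
move=> mD Da xD; have [mu [h1 h2 h3]] := scalar_spectral_measure x.
rewrite /real_dot h3/= -lee_fin fineK; last exact: integrable_fin_num.
rewrite (integral_spectral_subspace mD xD h1 h2).
have <- : (\int[mu]_(t in D) b%:E = (b * nrm x ^+ 2)%:E)%E.
  by rewrite integral_cst// h1// xD -EFinM.
apply: le_integral => //.
- exact: (integrableS measurableT).
- apply/integrableP; split; first exact: measurable_cst.
  by rewrite integral_cst// h1// xD -EFinM ltry.
- by move=> t /set_mem Dt; rewrite lee_fin; exact: Da.
Qed.

Lemma spectral_subspace_disj C D x : measurable C -> measurable D ->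
  C `&` D = set0 -> spectral_subspace D x -> E C x = 0.
Proof.
by move=> mC mD CD0 xD; rewrite -xD -spectral_measureI// CD0 spectral_measure0.
Qed.

Lemma spectral_subspaceC D x : measurable D ->
  spectral_subspace D x <-> E (~` D) x = 0.
Proof.
move=> mD; rewrite spectral_measureC//; split => [->|/eqP].
  by rewrite subrr.
by rewrite subr_eq0 => /eqP/esym.
Qed.

(** The scalar measure of x + y agrees with that of x on subsets of D and with
    that of y on subsets of the complement of D, so its integral splits. *)
Lemma form_spectral_subspaceD D x y : measurable D ->
  spectral_subspace D x -> spectral_subspace (~` D) y ->
  rdot (T (x + y)) (x + y) = rdot (T x) x + rdot (T y) y.
Proof.
move=> mD xD yD; have mDC := measurableC mD.
have [mu [h1 h2 h3]] := scalar_spectral_measure (x + y).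
have [mux [hx1 hx2 hx3]] := scalar_spectral_measure x.
have [muy [hy1 hy2 hy3]] := scalar_spectral_measure y.
have lE C : measurable C -> linear (E C) by move=> /pE[].
rewrite /real_dot h3 hx3 hy3/=; apply: EFin_inj.
rewrite EFinD !fineK ?integrable_fin_num//.
rewrite (integral_spectral_subspace mD xD hx1 hx2).
rewrite (integral_spectral_subspace mDC yD hy1 hy2).
rewrite -(setUv D) integral_setU//; last by apply/disj_setPS; rewrite setICr.
congr (_ + _)%E; apply: eq_measure_integral => C mC CD.
- rewrite h1// hx1// linear_opD; last exact: lE.
  rewrite (spectral_subspace_disj mC mDC _ yD) ?addr0//.
  by rewrite -subset0 => t [/CD].
- rewrite h1// hy1// linear_opD; last exact: lE.
  rewrite (spectral_subspace_disj mC mD _ xD) ?add0r//.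
  by rewrite -subset0 => t [/CD].
Qed.

(** This is the commutation of T with its spectral measure. By additivity of
    the form, <T x, y> has real part 0 for x in the range of E D and y in the
    range of E (~` D); take y = E (~` D) (T x). *)
Lemma invariant_spectral_subspace D : measurable D ->
  invariant_subspace T (spectral_subspace D).
Proof.
move=> mD; have mDC := measurableC mD; have [lE _ _] := pE mD; split; last first.
  move=> x y c xD yD; rewrite /spectral_subspace/= linear_opB// linear_opZ//.
  by rewrite xD yD.
move=> x xD; apply/spectral_subspaceC => //.
set y := E (~` D) (T x).
have yD : spectral_subspace (~` D) y by exact: spectral_subspaceE.
have := form_spectral_subspaceD mD xD yD.
rewrite linear_opD// !(rdotDl, rdotDr) (rdotC dot (T y) x).
rewrite -selfadjoint_rdot; last exact: spectral_measure_selfadjoint.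
have -> : rdot (T x) y = nrm y ^+ 2.
  by rewrite rdotC rdot_projection//; exact: pE.
by move=> h; apply: nrm_sqr_eq0; lra.
Qed.

Lemma cvg_spectral_measure0 (F : (set (measurableTypeR R))^nat) x :
  (forall n, measurable (F n)) -> nonincreasing_seq F ->
  \bigcap_n F n = set0 -> nrm (E (F n) x) ^+ 2 @[n --> \oo] --> (0 : R).
Proof.
move=> mF dF F0; have [mu [h _ _]] := scalar_spectral_measure x.
have : mu \o F @ \oo --> mu (\bigcap_n F n).
  by apply: nonincreasing_cvg_mu => //; rewrite ?h ?ltry// F0.
rewrite F0 measure0 (_ : mu \o F = EFin \o (fun n => nrm (E (F n) x) ^+ 2)).
  by move/fine_cvgP => -[].
by apply/funext => n/=; rewrite h.
Qed.
End SpectralMeasure.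

(** * Convergence of the cutoffs to a spectral projection *)
Section Cutoff.
Context {R : realType}.
Implicit Types (a t : R).

(** With m = k + 1, this is about t^(- 2m) / m. The factor 1 / m makes
    N t^(2m) tend to 0, at the threshold itself, while N a^(2m) still tends to
    infinity for every a > t, because (a / t)^(2m) beats m. *)
Definition cutoff_iter t k := Num.truncn (t ^- k.+1.*2 / k.+1%:R).

Lemma cutoff_iter_low t k : 0 < t ->
  (cutoff_iter t k)%:R * t ^+ k.+1.*2 <= k.+1%:R^-1.
Proof.
move=> t0; have h : 0 <= t ^- k.+1.*2 / k.+1%:R.
  by rewrite divr_ge0// invr_ge0 exprn_ge0// ltW.
rewrite -ler_pdivlMr ?exprn_gt0// mulrC.
by have /andP[] := truncn_itv h.
Qed.

Lemma bernoulli_ineq a n : 0 <= a -> 1 + n%:R * a <= (1 + a) ^+ n.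
Proof.
move=> a0; elim: n => [|n IH]; first by rewrite mul0r addr0.
rewrite exprS (le_trans _ (ler_wpM2l _ IH)) ?addr_ge0//.
have : 0 <= a * (n%:R * a) by rewrite !mulr_ge0.
by rewrite -natr1; lra.
Qed.

Lemma inv_bernoulli a n : 0 <= a <= 1 -> (1 - a) ^+ n <= (1 + n%:R * a)^-1.
Proof.
move=> /andP[a0 a1]; rewrite -[leRHS]mul1r ler_pdivlMr; last first.
  by rewrite ltr_pwDl// mulr_ge0.
elim: n => [|n IH]; first by rewrite mul0r addr0 mulr1.
apply: le_trans IH; rewrite exprSr -mulrA ler_wpM2l ?exprn_ge0 ?subr_ge0//.
have : 0 <= a * (n%:R * a) by rewrite !mulr_ge0.
have : 0 <= a * a by rewrite mulr_ge0.
by rewrite -natr1; lra.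
Qed.

Lemma cutoff_iter_high t a : 0 < t -> t < a -> a < 1 ->
  (1 - a ^+ k.+1.*2) ^+ cutoff_iter t k @[k --> \oo] --> (0 : R).
Proof.
move=> t0 ta a1; have a0 : 0 < a by exact: lt_trans ta.
pose d := a / t - 1.
have d0 : 0 < d by rewrite subr_gt0 ltr_pdivlMr// mul1r.
apply: (@squeeze_cvgr _ _ _ _ (fun=> 0)
  (fun k => (d ^+ 2)^-1 * k.+1%:R^-1)); last 2 first.
- exact: cvg_cst.
- rewrite -[X in _ --> X](mulr0 (d ^+ 2)^-1); apply: cvgMr.
  exact: cvg_harmonic.
near=> k; have u0 : 0 <= a ^+ k.+1.*2 by rewrite exprn_ge0// ltW.
have u1 : a ^+ k.+1.*2 <= 1 by rewrite exprn_ile1// ltW.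
rewrite exprn_ge0 ?subr_ge0//=.
apply: (le_trans (inv_bernoulli _ _)); first by rewrite u0.
rewrite -invfM lef_pV2 ?posrE; last 2 first.
- by rewrite ltr_pwDl// mulr_ge0.
- by rewrite mulr_gt0// exprn_gt0.
have hN : t ^- k.+1.*2 / k.+1%:R <= (cutoff_iter t k)%:R + 1.
  have h : 0 <= t ^- k.+1.*2 / k.+1%:R.
    by rewrite divr_ge0// invr_ge0 exprn_ge0// ltW.
  by have /andP[_ /ltW] := truncn_itv h; rewrite natr1.
have hr : (k.+1%:R * d) ^+ 2 <= (a / t) ^+ k.+1.*2.
  have [d0' a0' t0'] := And3 (ltW d0) (ltW a0) (ltW t0).
  rewrite -muln2 exprM.
  rewrite ler_pXn2r ?nnegrE ?mulr_ge0 ?exprn_ge0 ?divr_ge0//.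
  have -> : a / t = 1 + d by rewrite addrC subrK.
  by rewrite (le_trans _ (bernoulli_ineq k.+1 (ltW d0)))// lerDr.
have t0k : 0 < t ^+ k.+1.*2 by rewrite exprn_gt0.
have : (t ^- k.+1.*2 / k.+1%:R) * a ^+ k.+1.*2 <=
    ((cutoff_iter t k)%:R + 1) * a ^+ k.+1.*2 by rewrite ler_wpM2r.
have -> : t ^- k.+1.*2 / k.+1%:R * a ^+ k.+1.*2 = (a / t) ^+ k.+1.*2 / k.+1%:R.
  by rewrite expr_div_n mulrAC [t ^- _ * _]mulrC.
rewrite mulrDl mul1r => h.
have {}hr : d ^+ 2 * k.+1%:R <= (a / t) ^+ k.+1.*2 / k.+1%:R.
  rewrite ler_pdivlMr//; apply: le_trans hr.
  by rewrite le_eqVlt; apply/orP; left; apply/eqP; ring.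
by rewrite (le_trans hr)// (le_trans h)// addrC lerD2r.
Unshelve. all: by end_near.
Qed.
End Cutoff.

Section SpectralCutoff.
Context {R : realType} {H : completeNormedModType R[i]}.
Variable dot : {dot H for (Num.conj : R[i] -> R[i])}.
Hypothesis hdot : induces_norm dot.
Implicit Types (x y z : H) (A B P Q S T : H -> H) (a b c t M : R).
Implicit Types (C D : set (measurableTypeR R)).
Local Notation rdot := (real_dot dot).

(** Dividing by a bound M of the norm puts the form of T in the range [0, 1] on
    which the cutoff polynomials are controlled. *)
Definition spectral_cutoff T M t k : H -> H :=
  cutoff (fun x => (M^-1)%:C *: T x) k.+1 (cutoff_iter (t / M) k).

Section fixed_operator.
Variables (T : H -> H) (M t : R).
Hypothesis lT : linear T.
Hypothesis sT : selfadjoint dot T.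
Hypothesis T0 : forall x, 0 <= rdot (T x) x.
Hypothesis TM : forall x, nrm (T x) <= M * nrm x.
Hypothesis t0 : 0 < t.
Hypothesis tM : t < M.

Let M0 : 0 < M. Proof. exact: lt_trans tM. Qed.

Let A x := (M^-1)%:C *: T x.

Let lA : linear A.
Proof.
move=> c x y; rewrite /A (linear_opD _ _ lT) (linear_opZ _ _ lT).
by rewrite scalerDr !scalerA mulrC.
Qed.

Let sA : selfadjoint dot A.
Proof.
move=> x y; rewrite /A linearZl_LR linearZr_LR/= sT; congr (_ * _).
by rewrite conjCE conjc_real.
Qed.

Let A01 x : 0 <= rdot (A x) x <= nrm x ^+ 2.
Proof.
rewrite /A rdotZl mulr_ge0 ?invr_ge0 ?(ltW M0)//= ler_pdivrMl//.
rewrite (le_trans (ler_norm _))// (le_trans (CauchySchwarz_rdot hdot _ _))//.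
by rewrite expr2 mulrA ler_wpM2r ?nrm_ge0.
Qed.

Lemma selfadjoint_spectral_cutoff k : selfadjoint dot (spectral_cutoff T M t k).
Proof. exact: selfadjoint_cutoff. Qed.

Lemma linear_spectral_cutoff k : linear (spectral_cutoff T M t k).
Proof. exact: linear_cutoff. Qed.

Lemma nrm_spectral_cutoff k x : nrm (spectral_cutoff T M t k x) <= 2 * nrm x.
Proof.
have := nrm_cutoffC hdot k.+1 lA sA A01 (cutoff_iter (t / M) k) x.
rewrite -/(spectral_cutoff T M t k).
have := ler_nrmB x (x - spectral_cutoff T M t k x).
rewrite opprB addrC subrK; lra.
Qed.

(** By induction on the number N of iterations: if f = 1 - (1 - v)^N, the next
    polynomial is f + v - v f, which needs no unit. *)
Lemma star_algebra_spectral_cutoff k :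
  star_algebra dot T (spectral_cutoff T M t k).
Proof.
have hA : star_algebra dot T A by exact/star_algebra_scale/star_algebra_gen.
have hAm m : star_algebra dot T (iter m.+1 A).
  elim: m => [|m IH]; first exact: hA.
  exact: (star_algebra_mul hA IH).
rewrite /spectral_cutoff /cutoff -/A.
set S := iter k.+1.*2 A; have hS : star_algebra dot T S by rewrite /S doubleS.
have lS : linear S by exact: linear_iter.
elim: (cutoff_iter _ _) => [|N IH].
  rewrite (_ : (fun x => _) = fun x => 0 *: T x); last first.
    by apply/funext => x/=; rewrite subrr scale0r.
  exact/star_algebra_scale/star_algebra_gen.
pose B x := x - iter N (fun y => y - S y) x.
rewrite (_ : (fun x => _) = fun x => (B x + S x) + (-1) *: (S \o B) x).
  apply: star_algebra_add; first exact: star_algebra_add.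
  exact/star_algebra_scale/star_algebra_mul.
apply/funext => x; rewrite /= /B (linear_opB _ _ lS) scaleN1r !opprB.
by rewrite -[RHS]addrA [S x + _]addrC subrK -addrA [- _ + _]addrC.
Qed.

Variable E : set (measurableTypeR R) -> H -> H.
Hypothesis hE : is_spectral_measure dot T E.

Let mitv (i : interval R) : measurable ([set` i] : set (measurableTypeR R)).
Proof. exact: measurable_itv. Qed.

(** Split x along ]-oo, t], ]t, a] and ]a, +oo[ with t < a. For a close to t the
    middle part is small, and the complement of the cutoff is a contraction, so
    that part contributes little for every k. Once a is fixed, the other two
    contributions tend to 0 with k. *)
Lemma cvg_spectral_cutoff x :
  nrm (spectral_cutoff T M t k x - E `]t, +oo[%classic x)
    @[k --> \oo] --> (0 : R).
Proof.
pose F n := `]t, t + n.+1%:R^-1]%classic : set (measurableTypeR R).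
have mF n : measurable (F n) by exact: mitv.
have F_cvg0 : nrm (E (F n) x) ^+ 2 @[n --> \oo] --> (0 : R).
  apply: (cvg_spectral_measure0 hdot hE) => //.
    move=> m n mn; apply/subsetPset => y; rewrite /F/= !in_itv/= => /andP[->/=].
    move=> /le_trans; apply; rewrite lerD2l lef_pV2 ?posrE// ler_nat.
    exact: leq_ltn_trans mn _.
  rewrite -subset0 => y Fy.
  have := Fy 0%N I; rewrite /F/= in_itv/= => /andP[ty _].
  have yt0 : 0 < (y - t)^-1 by rewrite invr_gt0 subr_gt0.
  have /andP[_ hn] := truncn_itv (ltW yt0).
  have := Fy (Num.truncn (y - t)^-1) I; rewrite /F/= in_itv/= => /andP[_].
  by apply/negP; rewrite -ltNge -ltrBrDl -[ltRHS]invrK ltf_pV2 ?posrE.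
apply/cvgrPdist_lt => e e0.
have [n [ne nM]] : exists n, nrm (E (F n) x) < e / 2 /\ t + n.+1%:R^-1 < M.
  have e20 : 0 < (e / 2) ^+ 2 by rewrite exprn_gt0// divr_gt0.
  have Mt0 : 0 < M - t by rewrite subr_gt0.
  move/cvgrPdist_lt : F_cvg0 => /(_ _ e20) hF.
  have hM := near_infty_natSinv_lt (PosNum Mt0).
  have [n [h1 h2]] := filter_ex (filterI hF hM).
  exists n; split; last by rewrite addrC -ltrBrDr.
  rewrite -(@ltr_pXn2r _ 2)// ?nnegrE ?nrm_ge0 ?divr_ge0 ?(ltW e0)//.
  by move: h1; rewrite sub0r normrN ger0_norm ?sqr_ge0.
pose a := t + n.+1%:R^-1.
have ta : t < a by rewrite ltrDl.
pose D0 := `]-oo, t]%classic : set (measurableTypeR R).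
pose D1 := `]t, a]%classic : set (measurableTypeR R).
pose D2 := `]a, +oo[%classic : set (measurableTypeR R).
have mD0 : measurable D0 by exact: mitv.
have mD1 : measurable D1 by exact: mitv.
have mD2 : measurable D2 by exact: mitv.
have Et : E `]t, +oo[%classic x = E D1 x + E D2 x.
  rewrite -(spectral_measureU hdot hE)//; last first.
    rewrite -subset0 => s; rewrite /D1 /D2/= !in_itv/= andbT => -[/andP[_]].
    by rewrite leNgt => /negP.
  congr (E _ x); apply/seteqP; split => s; rewrite /D1 /D2/= !in_itv/= !andbT.
    by move=> ->; have [|] := leP s a; [left|right].
  by case=> [/andP[]//|]; exact: lt_trans.
have Ex : x = E D0 x + E `]t, +oo[%classic x.
  rewrite -(spectral_measureU hdot hE)//; last first.
    rewrite -subset0 => s; rewrite /D0/= !in_itv/= andbT => -[].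
    by rewrite leNgt => /negP.
  rewrite (_ : D0 `|` _ = setT) ?(spectral_measureT hE)//.
  rewrite -subTset => s _; rewrite /D0/= !in_itv/= andbT.
  by have [|] := leP s t; [left|right].
pose C := spectral_cutoff T M t.
have lC k : linear (C k) by exact: linear_spectral_cutoff.
have invA D : measurable D -> invariant_subspace A (spectral_subspace E D).
  move=> mD; have [hT hB] := invariant_spectral_subspace hdot lT hE mD.
  split => // y yD; have y0 : spectral_subspace E D 0.
    by rewrite -(subrr y) -[X in _ - X]scale1r; exact: hB.
  have := hB _ _ (- M^-1) y0 (hT _ yD).
  by rewrite rmorphN scaleNr opprK add0r.
have h0 k : nrm (C k (E D0 x)) <= k.+1%:R^-1 * nrm x.
  have b0 : 0 < t / M by rewrite divr_gt0.
  have hD0 y : spectral_subspace E D0 y -> rdot (A y) y <= t / M * nrm y ^+ 2.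
    move=> yD0; rewrite /A rdotZl mulrC mulrAC ler_wpM2r ?invr_ge0 ?(ltW M0)//.
    exact: (rdot_spectral_subspace_le hdot hE mD0).
  have := nrm_cutoff_low hdot k.+1 lA sA A01 (cutoff_iter (t / M) k)
    (invA _ mD0) b0 hD0 (spectral_subspaceE hE x mD0).
  move=> /le_trans; apply.
  apply: ler_pM; rewrite ?nrm_ge0//.
  - by apply: mulr_ge0 => //; apply: exprn_ge0; exact: ltW.
  - exact: cutoff_iter_low.
  - by apply: nrm_projection_le => //; exact: spectral_projection hE _ _.
have h1 k : nrm (E D1 x - C k (E D1 x)) < e / 2.
  exact: le_lt_trans (nrm_cutoffC hdot _ lA sA A01 _ _) ne.
have h2 k : nrm (E D2 x - C k (E D2 x)) <=
    (1 - (a / M) ^+ k.+1.*2) ^+ cutoff_iter (t / M) k * nrm x.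
  have aM : 0 <= a / M < 1.
    rewrite divr_ge0 ?(ltW M0) ?(ltW (lt_trans t0 ta))//=.
    by rewrite ltr_pdivrMr// mul1r.
  have hD2 y : spectral_subspace E D2 y -> a / M * nrm y ^+ 2 <= rdot (A y) y.
    move=> yD2; rewrite /A rdotZl mulrAC [leRHS]mulrC.
    rewrite ler_wpM2r ?invr_ge0 ?(ltW M0)//.
    apply: (rdot_spectral_subspace_ge hdot hE mD2) => // s.
    by rewrite /D2/= in_itv/= andbT => /ltW.
  have := nrm_cutoffC_high hdot lA sA A01 (cutoff_iter (t / M) k)
    (invA _ mD2) (ltn0Sn k) aM hD2 (spectral_subspaceE hE x mD2).
  move=> /le_trans; apply; rewrite ler_wpM2l//.
    rewrite exprn_ge0// subr_ge0 exprn_ile1//; first by case/andP: aM.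
    by case/andP: aM => _ /ltW.
  by apply: nrm_projection_le => //; exact: spectral_projection hE _ _.
have hk k : nrm (C k x - E `]t, +oo[%classic x) < e / 2 +
   (k.+1%:R^-1 * nrm x +
    (1 - (a / M) ^+ k.+1.*2) ^+ cutoff_iter (t / M) k * nrm x).
  have -> : C k x - E `]t, +oo[%classic x =
      C k (E D0 x) - ((E D1 x - C k (E D1 x)) + (E D2 x - C k (E D2 x))).
    rewrite [in C k x]Ex Et !(linear_opD _ _ (lC k)).
    move: (E D1 x) (E D2 x) (C k (E D0 x)) (C k (E D1 x)) (C k (E D2 x)).
    move=> e1 e2 c0 c1 c2.
    by rewrite [in RHS]addrACA -opprD opprB -[LHS]addrA.
  have := ler_nrmB (C k (E D0 x))
    ((E D1 x - C k (E D1 x)) + (E D2 x - C k (E D2 x))).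
  have := ler_nrmD (E D1 x - C k (E D1 x)) (E D2 x - C k (E D2 x)).
  move: (h0 k) (h1 k) (h2 k).
  move: (k.+1%:R^-1 * nrm x) ((1 - _) ^+ _ * nrm x) => u v; lra.
have g0 : k.+1%:R^-1 * nrm x +
    (1 - (a / M) ^+ k.+1.*2) ^+ cutoff_iter (t / M) k * nrm x
    @[k --> \oo] --> (0 : R).
  rewrite -[X in _ --> X](addr0 0); apply: cvgD.
    rewrite -[X in _ --> X](mul0r (nrm x)).
    by apply: cvgMl; exact: cvg_harmonic.
  rewrite -[X in _ --> X](mul0r (nrm x)); apply: cvgMl; apply: cutoff_iter_high.
  - by rewrite divr_gt0.
  - by rewrite ltr_pM2r ?invr_gt0.
  - by rewrite ltr_pdivrMr// mul1r.
have e20 : 0 < e / 2 by rewrite divr_gt0.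
move/cvgrPdist_lt : g0 => /(_ _ e20); apply: filterS => k.
rewrite !sub0r !normrN [X in _ -> X < _]ger0_norm ?nrm_ge0// => /ltr_normlW.
move: (hk k).
move: (_ + _ * nrm x) => u; lra.
Qed.
End fixed_operator.
End SpectralCutoff.

(** * Uniqueness and positivity of spectral projections *)
Section Uniqueness.
Context {R : realType} {H : completeNormedModType R[i]}.
Variable dot : {dot H for (Num.conj : R[i] -> R[i])}.
Hypothesis hdot : induces_norm dot.
Implicit Types (x y z : H) (A B P Q S T : H -> H) (a b c t M : R).
Implicit Types (C D : set (measurableTypeR R)).
Local Notation rdot := (real_dot dot).

Lemma squeeze_eq0 (u : R^nat) a : 0 <= a -> u n @[n --> \oo] --> (0 : R) ->
  (forall n, a <= u n) -> a = 0.
Proof.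
move=> a0 u0 au; apply/eqP; rewrite eq_le a0 andbT.
by apply: (cvgr_to_ge u0); exact: nearW.
Qed.

Lemma bounded_operator_nrm T a : bounded_operator T ->
  exists2 M, a < M & forall x, nrm (T x) <= M * nrm x.
Proof.
move=> [_ [M0 hM0]]; exists (Num.max (complex.Re M0) (a + 1)).
  by rewrite lt_max ltrDl ltr01 orbT.
move=> x; have := hM0 x; rewrite !normE lecE => /andP[_ /=].
have -> : complex.Re (M0 * (nrm x)%:C) = complex.Re M0 * nrm x.
  by case: M0 {hM0} => ? ? /=; rewrite mulr0 subr0.
by move=> /le_trans; apply; rewrite ler_wpM2r ?nrm_ge0// le_max lexx.
Qed.

Lemma positive_operatorP T x : positive_operator dot T -> 0 <= rdot (T x) x.
Proof. by move=> /(_ x); rewrite lecE => /andP[]. Qed.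

Lemma positive_operator_selfadjoint T : linear T -> positive_operator dot T ->
  selfadjoint dot T.
Proof.
by move=> lT T0; apply: real_form_selfadjoint => // x; exact/ger0_Im/T0.
Qed.

(** The approximants are built from T alone. This makes the limit independent
    of the spectral measure, and lets identities between elements of the
    generated algebras pass to spectral projections. *)
Lemma spectral_approximation T t : bounded_operator T ->
  positive_operator dot T -> 0 < t -> exists c : nat -> H -> H,
  [/\ forall k, star_algebra dot T (c k),
      forall k, linear (c k),
      forall k, selfadjoint dot (c k),
      forall k x, nrm (c k x) <= 2 * nrm x &
      forall E, is_spectral_measure dot T E -> forall x,
        nrm (c k x - E `]t, +oo[%classic x) @[k --> \oo] --> (0 : R)].
Proof.
move=> bT T0 t0; have [lT _] := bT; have [M tM TM] := bounded_operator_nrm t bT.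
have sT := positive_operator_selfadjoint lT T0.
have T0' x := positive_operatorP x T0.
exists (spectral_cutoff T M t); split.
- by move=> k; exact: star_algebra_spectral_cutoff.
- by move=> k; exact: linear_spectral_cutoff.
- by move=> k; exact: selfadjoint_spectral_cutoff.
- by move=> k x; exact: nrm_spectral_cutoff.
- by move=> E hE x; exact: cvg_spectral_cutoff.
Qed.

Lemma spectral_measure_uniq T E1 E2 t : bounded_operator T ->
  positive_operator dot T -> is_spectral_measure dot T E1 ->
  is_spectral_measure dot T E2 -> 0 < t ->
  E1 `]t, +oo[%classic = E2 `]t, +oo[%classic.
Proof.
move=> bT T0 h1 h2 t0; apply/funext => x.
have [c [_ _ _ _ hc]] := spectral_approximation bT T0 t0.
have h : nrm (c k x - E2 `]t, +oo[%classic x) +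
    nrm (c k x - E1 `]t, +oo[%classic x)
    @[k --> \oo] --> (0 : R).
  by rewrite -[X in _ --> X](addr0 0); apply: cvgD; exact: hc.
apply: nrmB_eq0; apply: (squeeze_eq0 (nrm_ge0 _) h) => k.
apply: le_trans (ler_nrmB _ _).
by rewrite opprB [in leRHS]addrC addrA subrK.
Qed.

(** On the range of E ]-oo, - 1 / (n + 1)] the form of T is both nonnegative and
    at most - |y|^2 / (n + 1), so this range is trivial. *)
Lemma positive_spectral_measure_neg T E x : linear T -> positive_operator dot T ->
  is_spectral_measure dot T E -> E `]-oo, 0[%classic x = 0.
Proof.
move=> lT T0 hE.
have mitv (i : interval R) : measurable ([set` i] : set (measurableTypeR R)).
  exact: measurable_itv.
pose F n := `]- n.+1%:R^-1, 0[%classic : set (measurableTypeR R).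
have mF n : measurable (F n) by exact: mitv.
have F_cvg0 : nrm (E (F n) x) ^+ 2 @[n --> \oo] --> (0 : R).
  apply: (cvg_spectral_measure0 hdot hE) => //.
    move=> m n mn; apply/subsetPset => y; rewrite /F/= !in_itv/= => /andP[+ ->].
    rewrite andbT; apply: le_lt_trans; rewrite lerN2 lef_pV2 ?posrE// ler_nat.
    exact: leq_ltn_trans mn _.
  rewrite -subset0 => y Fy.
  have := Fy 0%N I; rewrite /F/= in_itv/= => /andP[_ y0].
  have yt0 : 0 < (- y)^-1 by rewrite invr_gt0 oppr_gt0.
  have /andP[_ hn] := truncn_itv (ltW yt0).
  have := Fy (Num.truncn (- y)^-1) I; rewrite /F/= in_itv/= => /andP[+ _].
  apply/negP; rewrite -leNgt lerNr -[leRHS]invrK lef_pV2 ?posrE ?oppr_gt0//.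
  exact: ltW.
apply: nrm_sqr_eq0.
apply: (squeeze_eq0 (sqr_ge0 _) F_cvg0) => n.
have mD : measurable
    (`]-oo, - n.+1%:R^-1]%classic : set (measurableTypeR R)) by exact: mitv.
have -> : E `]-oo, 0[%classic x = E `]-oo, (- n.+1%:R^-1)]%classic x + E (F n) x.
  rewrite -(spectral_measureU hdot hE)//; last first.
    rewrite -subset0 => s; rewrite /F/= !in_itv/= => -[+ /andP[+ _]].
    by rewrite leNgt => /negP.
  congr (E _ x); apply/seteqP; split => s; rewrite /F/= !in_itv/=.
    by move=> ->; have [|] := leP s (- n.+1%:R^-1); [left|right].
  case=> [|/andP[]//] /le_lt_trans; apply; by rewrite oppr_lt0.
have yD := spectral_subspaceE hE x mD.
set y := E _ x in yD *.
suff -> : y = 0 by rewrite add0r.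
have : rdot (T y) y <= - n.+1%:R^-1 * nrm y ^+ 2.
  by apply: (rdot_spectral_subspace_le hdot hE mD) => // s; rewrite /= in_itv.
have := positive_operatorP y T0 => h1 h2.
have : 0 <= - n.+1%:R^-1 * nrm y ^+ 2 by exact: le_trans h2.
rewrite mulNr oppr_ge0 pmulr_rle0 ?invr_gt0// => h3.
by apply: nrm_sqr_eq0; apply/eqP; rewrite eq_le h3 sqr_ge0.
Qed.

Lemma positive_spectral_measure_gt T E t x : linear T -> positive_operator dot T ->
  is_spectral_measure dot T E -> t < 0 -> E `]t, +oo[%classic x = x.
Proof.
move=> lT T0 hE t0.
have mitv (i : interval R) : measurable ([set` i] : set (measurableTypeR R)).
  exact: measurable_itv.
rewrite -[in LHS](setCK `]t, +oo[%classic) (spectral_measureC hdot hE); last first.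
  by apply: measurableC; exact: mitv.
suff -> : E (~` `]t, +oo[%classic) x = 0 by rewrite subr0.
rewrite (_ : ~` _ = `]-oo, t] `&` `]-oo, 0[)%classic.
  rewrite (spectral_measureI hE)//.
  rewrite (positive_spectral_measure_neg x lT T0 hE) linear_op0//.
  by have [] := spectral_projection hE (mitv `]-oo, t]).
apply/seteqP; split => s; rewrite /= !in_itv/= andbT.
  by move/negP; rewrite -leNgt => st; split => //; exact: le_lt_trans st _.
by case=> st _; apply/negP; rewrite -leNgt.
Qed.

(** The form of T at x is at least t |x|^2 for every t < 0. *)
Lemma spectral_measure_positive T E : linear T -> is_spectral_measure dot T E ->
  (forall t x, t < 0 -> E `]t, +oo[%classic x = x) -> positive_operator dot T.
Proof.
move=> lT hE h x.
suff : 0 <= rdot (T x) x.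
  rewrite lecE/= => ->; rewrite andbT.
  by have [mu [_ _ ->]] := scalar_spectral_measure hdot hE x.
apply/ler_addgt0Pl => e e0.
have n0 : 0 < nrm x ^+ 2 + 1 by rewrite ltr_wpDl// sqr_ge0.
have t0 : - (e / (nrm x ^+ 2 + 1)) < 0 by rewrite oppr_lt0 divr_gt0.
have mD : measurable
    (`]- (e / (nrm x ^+ 2 + 1)), +oo[%classic : set (measurableTypeR R)).
  exact: measurable_itv.
have : - (e / (nrm x ^+ 2 + 1)) * nrm x ^+ 2 <= rdot (T x) x.
  apply: (rdot_spectral_subspace_ge hdot hE mD) => [s|]; last exact: h.
  by rewrite /= in_itv/= andbT => /ltW.
have : e / (nrm x ^+ 2 + 1) * nrm x ^+ 2 <= e.
  by rewrite mulrAC ler_pdivrMr// ler_wpM2l ?(ltW e0)// lerDl.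
rewrite mulNr; lra.
Qed.
End Uniqueness.

(** * Boolean independence of spectral projections *)
Section Boolean.
Context {R : realType} {H : completeNormedModType R[i]}.
Variable dot : {dot H for (Num.conj : R[i] -> R[i])}.
Hypothesis hdot : induces_norm dot.
Variables (xi : H) (V : nat -> H -> H).
Hypothesis hxi : `|xi| = 1.
Hypothesis hVbounded : forall n, bounded_operator (V n).
Hypothesis hVpositive : forall n, positive_operator dot (V n).
Hypothesis hVindep : boolean_independent dot xi V.
Implicit Types (a b : H -> H) (i j : nat).
Local Notation rdot := (real_dot dot).
Local Notation phi := (vector_state dot xi).

Lemma boolean_independent2 i j a b : i <> j ->
  star_algebra dot (V i) a -> star_algebra dot (V j) b ->
  phi (a \o b) = phi a * phi b.
Proof.
move=> ij ha hb.
have := @hVindep 2 (fun k => if k == 0%N then i else j)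
  (fun k => if k == 0%N then a else b).
rewrite !big_ord_recl !big_ord0/= mulr1; apply => //.
  by case=> [|[|]].
by case.
Qed.

Lemma boolean_independent3 i j a b : i <> j ->
  star_algebra dot (V i) a -> star_algebra dot (V j) b ->
  phi (b \o a \o b) = phi b * phi a * phi b.
Proof.
move=> ij ha hb.
have := @hVindep 3 (fun k => if k == 1%N then i else j)
  (fun k => if k == 1%N then a else b).
rewrite !big_ord_recl !big_ord0/= mulr1 mulrA; apply => //.
  by case=> [|[|[|]]].
by move=> [|[|]]//= _; exact/nesym.
Qed.

(** The squared norm of the difference is
    phi (b a^2 b) - 2 phi b phi (a^2 b) + (phi b)^2 phi (a^2), and independence
    evaluates each term to (phi b)^2 phi (a^2), up to its coefficient. *)
Lemma boolean_independent_vector i j a b : i <> j ->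
  star_algebra dot (V i) a -> star_algebra dot (V j) b ->
  selfadjoint dot a -> selfadjoint dot b ->
  a (b xi) = (rdot (b xi) xi)%:C *: a xi.
Proof.
move=> ij ha hb sa sb.
have phibE : phi b = (rdot (b xi) xi)%:C.
  rewrite RRe_real//; apply/CrealP; rewrite -dotC.
  by rewrite /vector_state -sb.
have phiaaE : phi (a \o a) = (nrm (a xi) ^+ 2)%:C.
  by rewrite /vector_state/= sa hdot normE rmorphXn.
have haa := star_algebra_mul ha ha.
have h3 := boolean_independent3 ij haa hb.
have h2 := boolean_independent2 ij haa hb.
have h3' : rdot (a (b xi)) (a (b xi)) = rdot (b xi) xi ^+ 2 * nrm (a xi) ^+ 2.
  rewrite /real_dot -sa -sb [dot _ _]h3 phibE phiaaE -!rmorphM/=.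
  rewrite /real_dot; ring.
have h2' : rdot (a (b xi)) (a xi) = rdot (b xi) xi * nrm (a xi) ^+ 2.
  by rewrite /real_dot -sa [dot _ _]h2 phibE phiaaE -rmorphM/= mulrC.
apply: nrmB_sqr_eq0.
rewrite (nrmB_sqr hdot) nrmZ rdotZr exprMn real_normK ?num_real//.
rewrite -(rdotxx hdot) h3' h2'.
ring.
Qed.

Variable E : nat -> set (measurableTypeR R) -> H -> H.
Hypothesis hE : forall j, is_spectral_measure dot (V j) (E j).
Variable t : R.
Hypothesis t0 : 0 < t.
Let P j := E j `]t, +oo[%classic.

(** Approximate P j first, with the element a of the algebra of V i fixed, and
    only then P i: each passage needs the continuity of a single operator. *)
Lemma boolean_independent_projection i j : i <> j ->
  P i (P j xi) = (rdot (P j xi) xi)%:C *: P i xi.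
Proof.
move=> ij.
have [a [ha la sa na ca]] :=
  spectral_approximation hdot (hVbounded i) (hVpositive i) t0.
have [b [hb lb sb nb cb]] :=
  spectral_approximation hdot (hVbounded j) (hVpositive j) t0.
have {}ca x := ca _ (hE i) x; have {}cb x := cb _ (hE j) x.
have nxi : nrm xi = 1 by rewrite /nrm hxi.
have aP k : a k (P j xi) = (rdot (P j xi) xi)%:C *: a k xi.
  apply: nrmB_eq0.
  have h : (2 + nrm (a k xi)) * nrm (b l xi - P j xi) @[l --> \oo] --> (0 : R).
    rewrite -[X in _ --> X](mulr0 (2 + nrm (a k xi))).
    by apply: cvgMr; exact: cb.
  apply: (squeeze_eq0 (nrm_ge0 _) h) => l.
  have -> : a k (P j xi) - (rdot (P j xi) xi)%:C *: a k xi =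
    (rdot (b l xi - P j xi) xi)%:C *: a k xi - a k (b l xi - P j xi).
    rewrite linear_opB// (boolean_independent_vector ij (ha k) (hb l))//.
    by rewrite rdotDl rdotNl rmorphB scalerBl opprB [RHS]addrC addrA subrK.
  rewrite (le_trans (ler_nrmB _ _))// nrmZ mulrDl addrC lerD//.
  rewrite mulrC ler_wpM2l ?nrm_ge0//.
  by rewrite (le_trans (CauchySchwarz_rdot hdot _ _))// nxi mulr1.
apply: nrmB_eq0.
set p := rdot (P j xi) xi in aP *.
have h : `|p| * nrm (a k xi - P i xi) + nrm (a k (P j xi) - P i (P j xi))
    @[k --> \oo] --> (0 : R).
  rewrite -[X in _ --> X](addr0 0); apply: cvgD; last exact: ca.
  by rewrite -[X in _ --> X](mulr0 `|p|); apply: cvgMr; exact: ca.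
apply: (squeeze_eq0 (nrm_ge0 _) h) => k.
rewrite -nrmZ; apply: le_trans (ler_nrmB _ _).
by rewrite aP scalerBr opprB [in leRHS]addrC addrA subrK.
Qed.
End Boolean.

(** * Joins of projections and running maxima *)
Section Join.
Context {R : realType} {H : completeNormedModType R[i]}.
Variable dot : {dot H for (Num.conj : R[i] -> R[i])}.
Hypothesis hdot : induces_norm dot.
Implicit Types (x y z : H) (T P Q J : H -> H).
Local Notation rdot := (real_dot dot).

Lemma projection_join_ge P Q J : orthogonal_projection dot P ->
  orthogonal_projection dot Q -> is_projection_join dot P Q J ->
  (forall x, J (P x) = P x) /\ (forall x, J (Q x) = Q x).
Proof.
move=> [lP _ _] [lQ _ _] [pJ rJ].
have JK z :
    closure [set P x + Q y | x in [set: H] & y in [set: H]] z -> J z = z.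
  by rewrite -rJ => -[y _ <-]; exact: projectionK pJ.
split=> x; apply: JK; apply: subset_closure.
  by exists x => //; exists 0 => //; rewrite (linear_op0 lQ) addr0.
by exists 0 => //; exists x => //; rewrite (linear_op0 lP) add0r.
Qed.

(** Being orthogonal to both ranges, z has distance at least |z| to every
    element of their sum, hence to J z, which is a limit of such elements. But
    |z - J z|^2 = |z|^2 - |J z|^2. *)
Lemma projection_join_ker P Q J z : orthogonal_projection dot P ->
  orthogonal_projection dot Q -> is_projection_join dot P Q J ->
  P z = 0 -> Q z = 0 -> J z = 0.
Proof.
move=> [lP _ sP] [lQ _ sQ] [pJ rJ] Pz0 Qz0; have [lJ _ sJ] := pJ.
have zJz : nrm z <= nrm (z - J z).
  apply/ler_addgt0Pl => e e0.
  have : closure [set P x + Q y | x in [set: H] & y in [set: H]] (J z).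
    by rewrite -rJ; exists z.
  have ec0 : 0 < e%:C by rewrite ltcR.
  (* A point P x + Q y of the sum at distance less than e from J z. *)
  move=> /(_ _ (nbhsx_ballx (J z) _ ec0))[_ [[x _ [y _ <-]]]].
  rewrite -ball_normE/= normE ltcR => hw.
  have : nrm z <= nrm (z - (P x + Q y)).
    rewrite -(@ler_pXn2r _ 2)// ?nnegrE ?nrm_ge0// (nrmB_sqr hdot).
    rewrite rdotDr -!selfadjoint_rdot// Pz0 Qz0 /real_dot !linear0l.
    rewrite addr0 mulr0 subr0.
    by rewrite lerDl sqr_ge0.
  have -> : z - (P x + Q y) = (J z - (P x + Q y)) + (z - J z).
    by rewrite [RHS]addrC addrA subrK.
  move=> /le_trans; apply; apply: (le_trans (ler_nrmD _ _)).
  by rewrite lerD2r ltW.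
apply: nrm_sqr_eq0; apply/eqP; rewrite eq_le sqr_ge0 andbT.
move: zJz; rewrite -(@ler_pXn2r _ 2)// ?nnegrE ?nrm_ge0// (nrmB_sqr hdot).
rewrite rdotC rdot_projection//; lra.
Qed.
End Join.

Section RunningMax.
Context {R : realType} {H : completeNormedModType R[i]}.
Variable dot : {dot H for (Num.conj : R[i] -> R[i])}.
Hypothesis hdot : induces_norm dot.
Variables (V W : nat -> H -> H).
Hypothesis hVbounded : forall n, bounded_operator (V n).
Hypothesis hVpositive : forall n, positive_operator dot (V n).
Hypothesis hW : is_running_max dot V W.
Implicit Types (x y z : H) (t : R).
Local Notation rdot := (real_dot dot).

Let mray t : measurable (`]t, +oo[%classic : set (measurableTypeR R)).
Proof. exact: measurable_itv. Qed.

Lemma running_max_bounded n : bounded_operator (W n).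
Proof.
case: hW => W0 WS; case: n => [|n]; first by rewrite W0.
by case: (WS n).
Qed.

(** For t < 0 the projections of a positive operator on ]t, +oo[ are the
    identity, hence so is their join. *)
Lemma running_max_positive n : positive_operator dot (W n).
Proof.
case: (hW) => W0 WS; elim: n => [|n IH]; first by rewrite W0.
have [[lW' _] _ [EX [EY [EZ [hX hY hZ hj]]]]] := WS n.
have [lW _] := running_max_bounded n.
apply: (spectral_measure_positive hdot lW' hZ) => t x t0.
have [h _] := projection_join_ge (spectral_projection hX (mray t))
  (spectral_projection hY (mray t)) (hj t).
by rewrite -{1}(positive_spectral_measure_gt hdot x lW IH hX t0) h
  (positive_spectral_measure_gt hdot x lW IH hX t0).
Qed.

Variables (EV EW : nat -> set (measurableTypeR R) -> H -> H).
Hypothesis hEV : forall n, is_spectral_measure dot (V n) (EV n).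
Hypothesis hEW : forall n, is_spectral_measure dot (W n) (EW n).

(** These two properties characterize EW n ]t, +oo[ as the join of the
    projections of V 0, ..., V n. *)
Lemma running_max_join n t : 0 < t ->
  (forall j x, (j <= n)%N ->
     EW n `]t, +oo[%classic (EV j `]t, +oo[%classic x) =
     EV j `]t, +oo[%classic x) /\
  (forall x, (forall j, (j <= n)%N -> EV j `]t, +oo[%classic x = 0) ->
     EW n `]t, +oo[%classic x = 0).
Proof.
move=> t0; case: (hW) => W0 WS.
elim: n => [|n [IH1 IH2]].
  have -> : EW 0%N `]t, +oo[%classic = EV 0%N `]t, +oo[%classic.
    apply: (spectral_measure_uniq hdot (hVbounded 0) (hVpositive 0)) => //.
    by rewrite -W0.
  split=> [j x|x]; last exact.
  rewrite leqn0 => /eqP ->; apply: projectionK.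
  exact: (spectral_projection (hEV 0%N) (mray t)).
have [_ _ [EX [EY [EZ [hX hY hZ hj]]]]] := WS n.
have uX := spectral_measure_uniq hdot (running_max_bounded n)
  (running_max_positive n) hX (hEW n) t0.
have uY := spectral_measure_uniq hdot (hVbounded n.+1)
  (hVpositive n.+1) hY (hEV n.+1) t0.
have uZ := spectral_measure_uniq hdot (running_max_bounded n.+1)
  (running_max_positive n.+1) hZ (hEW n.+1) t0.
have := hj t; rewrite uX uY uZ => hJ.
have pX := spectral_projection (hEW n) (mray t).
have pY := spectral_projection (hEV n.+1) (mray t).
have [JX JY] := projection_join_ge pX pY hJ.
split=> [j x|x hx].
  rewrite leq_eqVlt ltnS => /orP[/eqP ->|jn]; first exact: JY.
  by rewrite -(IH1 _ _ jn) JX.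
apply: (projection_join_ker hdot pX pY hJ); last exact: hx.
by apply: IH2 => j jn; apply: hx; rewrite leqW.
Qed.
End RunningMax.

(** * Scalar computations *)
Section RealLimits.
Context {R : realType}.
Implicit Types (s t u alpha : R).

Lemma uniform_prob_gt t : 0 <= t <= 1 ->
  uniform_prob (@ltr01 R) (`]t, +oo[%classic : set (measurableTypeR R)) =
  (1 - t)%:E.
Proof.
move=> /andP[t0 t1]; rewrite /uniform_prob integral_uniform_pdf.
have -> : `]t, +oo[%classic `&` `[0, 1]%classic = `]t, 1]%classic
    :> set (measurableTypeR R).
  apply/seteqP; split => x; rewrite /= !in_itv/= ?andbT.
    by case=> -> /andP[].
  by move=> /andP[tx x1]; rewrite tx x1 (le_trans t0 (ltW tx)).
rewrite (eq_integral (cst 1%:E)); last first.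
  move=> x; rewrite inE/= in_itv/= => /andP[tx x1].
  by rewrite /uniform_pdf (le_trans t0 (ltW tx)) x1 subr0 invr1.
rewrite integral_cst//= mul1e lebesgue_measure_itv/= lte_fin.
case: ltP => [_|t1']; first by rewrite EFinB.
have -> : t = 1 by apply/eqP; rewrite eq_le t1 t1'.
by rewrite subrr.
Qed.

(** With y = - ln u, the left side is 1 / (1 + (n + 1) (exp z - 1)) for
    z = y / (n + 1), and z <= exp z - 1 <= z / (1 - z). *)
Lemma cvg_law u : 0 <= u <= 1 ->
  (u `^ n.+1%:R^-1 / (1 + n%:R * (1 - u `^ n.+1%:R^-1)))
    @[n --> \oo] --> Xvee_inv u.
Proof.
move=> /andP[u0 u1]; have [->|un0] := eqVneq u 0.
  rewrite /Xvee_inv eqxx (_ : (fun n => _) = fun=> 0); first exact: cvg_cst.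
  by apply/funext => n; rewrite powR0 ?mul0r// invr_neq0.
have up : 0 < u by rewrite lt_def un0.
rewrite /Xvee_inv (negbTE un0).
set y := - ln u.
have y0 : 0 <= y by rewrite oppr_ge0 ln_le0.
rewrite -/y.
have sE n : u `^ n.+1%:R^-1 = (expR (y * n.+1%:R^-1))^-1.
  by rewrite /powR (negbTE un0) -expRN /y mulNr opprK mulrC.
rewrite (_ : (fun n => _) =
  fun n => (1 + n.+1%:R * (expR (y * n.+1%:R^-1) - 1))^-1); last first.
  apply/funext => n; rewrite sE -natr1.
  have e1 : 1 <= expR (y * (n%:R + 1)^-1).
    by rewrite -expR0 ler_expR mulr_ge0// invr_ge0 addr_ge0.
  move: (expR _) e1 => e e1.
  have e0 : e != 0 by rewrite gt_eqF// (lt_le_trans _ e1).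
  have d0 : 0 < e + n%:R * (e - 1).
    by rewrite ltr_pwDl ?(lt_le_trans _ e1)// mulr_ge0// subr_ge0.
  have -> : 1 + (n%:R + 1) * (e - 1) = e + n%:R * (e - 1) by ring.
  have -> : 1 + n%:R * (1 - e^-1) = (e + n%:R * (e - 1)) / e by field.
  by rewrite invfM invrK mulrCA mulVf// mulr1.
apply: cvgV; first by rewrite gt_eqF// ltr_pwDl.
apply: cvgD; first exact: cvg_cst.
apply: (@squeeze_cvgr _ _ _ _ (fun=> y) (fun n => y / (1 - y * n.+1%:R^-1))).
- have : \forall n \near \oo, y * n.+1%:R^-1 < 1.
    have : y * n.+1%:R^-1 @[n --> \oo] --> (0 : R).
      by rewrite -[X in _ --> X](mulr0 y); apply: cvgMr; exact: cvg_harmonic.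
    move/cvgrPdist_lt => /(_ _ ltr01); apply: filterS => n.
    by rewrite sub0r normrN => /ltr_normlW.
  apply: filterS => n yn1; set z := y * _ in yn1 *.
  have yE : y = n.+1%:R * z by rewrite /z mulrC mulfVK.
  apply/andP; split.
    by rewrite {1}yE ler_wpM2l// lerBrDl expR_ge1Dx.
  have z1 : 0 < 1 - z by rewrite subr_gt0.
  rewrite {1}yE -mulrA ler_wpM2l// lerBlDl.
  have -> : 1 + z / (1 - z) = (1 - z)^-1 by field; rewrite gt_eqF.
  rewrite -[leLHS]invrK lef_pV2 ?posrE ?invr_gt0 ?expR_gt0// -expRN.
  exact: expR_ge1Dx.
- exact: cvg_cst.
rewrite -[X in _ --> X](divr1 y); apply: cvgM; first exact: cvg_cst.
apply: cvgV => //; rewrite -[X in _ --> X](subr0 1).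
apply: cvgB; first exact: cvg_cst.
by rewrite -[X in _ --> X](mulr0 y); apply: cvgMr; exact: cvg_harmonic.
Qed.

Lemma Xvee_inv_frechet alpha x :
  Xvee_inv (frechet_cdf alpha x) = dagum_cdf alpha x.
Proof.
rewrite /Xvee_inv /frechet_cdf /dagum_cdf; case: ltP => x0; last by rewrite eqxx.
by rewrite gt_eqF ?expR_gt0// expRK opprK.
Qed.

Lemma frechet_cdf_itv alpha x : 0 <= frechet_cdf alpha x <= 1.
Proof.
rewrite /frechet_cdf; case: ltP => _; last by rewrite lexx ler01.
by rewrite expR_ge0/= -expR0 ler_expR oppr_le0 powR_ge0.
Qed.

Lemma cumulativeBounded01_itv (F : cumulativeBounded (0 : R) (1 : R)) x :
  0 <= F x <= 1.
Proof.
apply/andP; split.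
  apply: (cvgr_to_le (cumulativeNy F)); near=> y.
  by apply: cumulative_is_nondecreasing; near: y; exact: nbhs_ninfty_le.
apply: (cvgr_to_ge (cumulativey F)); near=> y.
by apply: cumulative_is_nondecreasing; near: y; exact: nbhs_pinfty_ge.
Unshelve. all: by end_near.
Qed.

Lemma powR_le1 u t : 0 <= u <= 1 -> 0 < t -> u `^ t <= 1.
Proof.
move=> /andP[u0 u1] t0; have [->|un0] := eqVneq u 0.
  by rewrite powR0 ?gt_eqF.
by rewrite -(powRr0 u) ger_powR ?(ltW t0)// lt_def un0 u0.
Qed.

End RealLimits.

(** * The distribution of the running maximum *)
Section Law.
Context {R : realType} {H : completeNormedModType R[i]}.
Variable dot : {dot H for (Num.conj : R[i] -> R[i])}.
Hypothesis hdot : induces_norm dot.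
Variables (xi : H) (V W : nat -> H -> H).
Hypothesis hxi : `|xi| = 1.
Hypothesis hVbounded : forall n, bounded_operator (V n).
Hypothesis hVpositive : forall n, positive_operator dot (V n).
Hypothesis hVindep : boolean_independent dot xi V.
Hypothesis hW : is_running_max dot V W.
Implicit Types (x y z : H) (s t p : R).
Variables (EV EW : nat -> set (measurableTypeR R) -> H -> H).
Hypothesis hEV : forall n, is_spectral_measure dot (V n) (EV n).
Hypothesis hEW : forall n, is_spectral_measure dot (W n) (EW n).
Local Notation rdot := (real_dot dot).

Let mitv (i : interval R) : measurable ([set` i] : set (measurableTypeR R)).
Proof. exact: measurable_itv. Qed.

(** The projection of xi on the range of J is a combination of the P j xi with
    equal coefficients c. The condition that P i kills xi - c (sum of the
    P j xi) reads 1 = c (1 + n p), since P i P j xi = p P i xi for j <> i. *)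
Lemma law_running_max_gt n t p : 0 < t -> 0 <= p ->
  (forall j, spectral_law dot xi (EV j) `]t, +oo[%classic = p) ->
  spectral_law dot xi (EW n) `]t, +oo[%classic = n.+1%:R * p / (1 + n%:R * p).
Proof.
move=> t0 p0 hp.
have [JP J0] := running_max_join hdot hVbounded hVpositive hW hEV hEW n t0.
set J := EW n `]t, +oo[%classic in JP J0 *.
pose P j := EV j `]t, +oo[%classic.
have pJ : orthogonal_projection dot J.
  exact: spectral_projection (hEW n) _ (mitv _).
have pP j : orthogonal_projection dot (P j).
  exact: spectral_projection (hEV j) _ (mitv _).
have [lJ _ _] := pJ.
have lP j : linear (P j) by case: (pP j).
have PP i j : i <> j -> P i (P j xi) = p%:C *: P i xi.
  move=> ij; rewrite /P.
  rewrite (boolean_independent_projection hdot hxi hVbounded hVpositive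
    hVindep hEV t0 ij).
  by rewrite -(hp j).
have c0 : 0 < 1 + n%:R * p by rewrite ltr_pwDl// mulr_ge0.
pose c := (1 + n%:R * p)^-1.
(* The candidate for J xi. *)
pose eta := c%:C *: \sum_(0 <= j < n.+1) P j xi.
have Peta i : (i <= n)%N -> P i (xi - eta) = 0.
  move=> ilen; rewrite linear_opB// /eta linear_opZ// linear_op_sum//.
  rewrite big_mkord (bigD1 (Ordinal (ilen : (i < n.+1)%N)))//=.
  rewrite (eq_bigr (fun=> p%:C *: P i xi)); last first.
    move=> j /eqP ji; apply: PP => ij; apply: ji; exact: val_inj.
  rewrite sumr_const cardC1 card_ord /= (projectionK _ (pP i)).
  rewrite -scaler_nat scalerA.
  rewrite -[X in X + _ *: _]scale1r -scalerDl scalerA.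
  rewrite (_ : c%:C * _ = 1) ?scale1r ?subrr//.
  rewrite (_ : 1 + _ = (1 + n%:R * p)%:C).
    by rewrite -rmorphM/= mulVf ?gt_eqF.
  by rewrite rmorphD rmorphM/= rmorph_nat.
have Jxi : J xi = eta.
  have := J0 _ Peta; rewrite linear_opB// => /eqP; rewrite subr_eq0 => /eqP ->.
  rewrite /eta linear_opZ// linear_op_sum//; congr (_ *: _).
  by rewrite !big_mkord; apply: eq_bigr => j _; apply: JP; rewrite -ltnS.
rewrite /spectral_law /vector_state -/J Jxi -/(rdot _ _) /eta rdotZl.
have -> : rdot (\sum_(0 <= j < n.+1) P j xi) xi = n.+1%:R * p.
  rewrite (big_morph (fun x => rdot x xi) (id1 := 0) (op1 := +%R)).
  - rewrite (eq_bigr (fun=> p)) => [|j _]; last by rewrite -(hp j).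
    by rewrite sumr_const_nat subn0 mulr_natl.
  - by move=> x y; rewrite rdotDl.
  - by rewrite /real_dot linear0l.
by rewrite mulrC.
Qed.

Hypothesis hlaw : forall j t, 0 < t -> t <= 1 ->
  spectral_law dot xi (EV j) `]t, +oo[%classic = 1 - t.

Lemma spectral_law_running_max_itv n s : 0 <= s ->
  spectral_law dot xi (EW n) `[0, s]%classic =
  1 - spectral_law dot xi (EW n) `]s, +oo[%classic.
Proof.
move=> s0.
have h : xi = EW n `[0, s]%classic xi + EW n `]s, +oo[%classic xi.
  rewrite -(spectral_measureU hdot (hEW n)) ?mitv//; last first.
    rewrite -subset0 => r; rewrite /= !in_itv/= andbT => -[/andP[_]].
    by rewrite leNgt => /negP.
  have -> : `[0, s]%classic `|` `]s, +oo[%classic = ~` `]-oo, 0[%classic :> set R.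
    apply/seteqP; split => r; rewrite /= !in_itv/= ?andbT.
      case=> [/andP[r0 _]|sr]; apply/negP; rewrite -leNgt//.
      by rewrite (le_trans s0)// ltW.
    by move=> /negP; rewrite -leNgt => ->; have [|] := leP r s; [left|right].
  rewrite (spectral_measureC hdot (hEW n))//.
  have [lW _] := running_max_bounded hVbounded hW n.
  rewrite (positive_spectral_measure_neg hdot xi lW _ (hEW n)) ?subr0//.
  exact: running_max_positive.
have : rdot xi xi = 1 by rewrite (rdotxx hdot) /nrm hxi expr1n.
rewrite {1}h rdotDl -/(rdot _ _) => <-.
by rewrite /spectral_law /vector_state /real_dot addrK.
Qed.

(** Thresholds s > 0 are covered by the join formula. The value at s = 0 is the
    limit from above, as the law of [0, 0] is at most that of [0, s]. *)
Lemma spectral_law_running_max n s : 0 <= s <= 1 ->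
  spectral_law dot xi (EW n) `[0, s]%classic = s / (1 + n%:R * (1 - s)).
Proof.
have pos r : 0 < r -> r <= 1 ->
    spectral_law dot xi (EW n) `[0, r]%classic = r / (1 + n%:R * (1 - r)).
  move=> r0 r1; rewrite spectral_law_running_max_itv ?(ltW r0)//.
  rewrite (law_running_max_gt n r0 (_ : 0 <= 1 - r)) ?subr_ge0//; last first.
    by move=> j; exact: hlaw.
  have d0 : 1 + n%:R * (1 - r) != 0.
    by rewrite gt_eqF// ltr_pwDl// mulr_ge0// subr_ge0.
  by rewrite -natr1; field.
move=> /andP[]; rewrite le_eqVlt => /orP[/eqP <- _|]; last exact: pos.
rewrite mul0r; apply/eqP; rewrite eq_le; apply/andP; split; last first.
  rewrite /spectral_law /vector_state -/(rdot _ _).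
  rewrite (rdot_projection hdot) ?sqr_ge0//.
  exact: spectral_projection (hEW n) _ (mitv _).
have mono r : 0 < r -> spectral_law dot xi (EW n) `[0, 0]%classic <=
    spectral_law dot xi (EW n) `[0, r]%classic.
  move=> r0; have p0 := spectral_projection (hEW n) (mitv `[0, 0]).
  have pr := spectral_projection (hEW n) (mitv `[0, r]).
  rewrite /spectral_law /vector_state -!/(rdot _ _) !(rdot_projection hdot)//.
  rewrite ler_pXn2r ?nnegrE ?nrm_ge0//.
  rewrite (_ : `[0, 0]%classic = `[0, 0]%classic `&` `[0, r]%classic); last first.
    apply/seteqP; split => x; rewrite /= !in_itv/=; last by case.
    by move=> /andP[x0 x1]; rewrite x0 x1 (le_trans x1)// ltW.
  by rewrite (spectral_measureI (hEW n))// (nrm_projection_le hdot _ p0).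
apply/ler_addgt0Pl => e e0; rewrite addr0.
pose r := Num.min e 1.
have r0 : 0 < r by rewrite lt_min e0 ltr01.
have r1 : r <= 1 by rewrite ge_min lexx orbT.
apply: (le_trans (mono _ r0)); rewrite pos//.
have : r <= e by rewrite ge_min lexx.
apply: le_trans; rewrite ler_pdivrMr; last first.
  by rewrite ltr_pwDl// mulr_ge0// subr_ge0.
by rewrite ler_peMr ?(ltW r0)// lerDl mulr_ge0// subr_ge0.
Qed.
End Law.

Theorem proposition5p3 (R : realType) (H : completeNormedModType R[i])
    (dot : {dot H for (Num.conj : R[i] -> R[i])}) (hdot : induces_norm dot)
    (xi : H) (hxi : `|xi| = 1)
    (V : nat -> H -> H)
    (hVbounded : forall n, bounded_operator (V n))
    (hVpositive : forall n, positive_operator dot (V n))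
    (hVindep : boolean_independent dot xi V)
    (hVident : forall n, same_distribution dot xi (V n) (V 0%N))
    (hVuniform : has_distribution dot xi (V 0%N) (uniform_prob (@ltr01 R)))
    (W : nat -> H -> H) (hW : is_running_max dot V W)
    (EW : nat -> set (measurableTypeR R) -> H -> H)
    (hEW : forall n, is_spectral_measure dot (W n) (EW n)) :
  (forall F : cumulativeBounded (0 : R) (1 : R),
     weak_cvg
       (fun n x => spectral_law dot xi (EW n)
                     `[0, F x `^ (n.+1%:R)^-1]%classic)
       (fun x => Xvee_inv (F x))) /\
  (forall alpha : R, 0 < alpha ->
     weak_cvg
       (fun n x => spectral_law dot xi (EW n)
                     `[0, frechet_cdf alpha x `^ (n.+1%:R)^-1]%classic)
       (dagum_cdf alpha)).
Proof.
have /choice[EV hEV] n : exists E, is_spectral_measure dot (V n) E.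
  by have [EX [_ [hX _ _]]] := hVident n; exists EX.
have hlaw j t : 0 < t -> t <= 1 ->
    spectral_law dot xi (EV j) `]t, +oo[%classic = 1 - t.
  move=> t0 t1; have [EX [EY [hX hY hXY]]] := hVident j.
  have [E hE hlaw] := hVuniform.
  have mt : measurable (`]t, +oo[%classic : set (measurableTypeR R)).
    exact: measurable_itv.
  have := hXY _ mt; have := hlaw _ mt.
  rewrite uniform_prob_gt ?t1 ?(ltW t0)// => -[h1].
  rewrite /spectral_law.
  rewrite (spectral_measure_uniq hdot (hVbounded j) (hVpositive j)
    hX (hEV j) t0).
  rewrite (spectral_measure_uniq hdot (hVbounded 0%N) (hVpositive 0%N)
    hY hE t0).
  by move=> ->.
have main u : 0 <= u <= 1 ->
    spectral_law dot xi (EW n) `[0, u `^ (n.+1%:R)^-1]%classic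
    @[n --> \oo] --> Xvee_inv u.
  move=> u01; have := cvg_law u01.
  apply: cvg_trans; apply: near_eq_cvg; apply: nearW => n.
  rewrite (spectral_law_running_max hdot hxi hVbounded hVpositive hVindep hW
    hEV hEW hlaw)//.
  by rewrite powR_ge0/= powR_le1.
split=> [F|alpha _] x _; first exact/main/cumulativeBounded01_itv.
by rewrite -Xvee_inv_frechet; exact/main/frechet_cdf_itv.
Qed.
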